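(* There exists a function $h$ from graphs to positive integers such that the following holds. Let $H$ be a graph, let $G$ be a finite graph that does not contain $H$ as a topological minor, and let $A,B \subseteq V(G)$. Then for every positive integer $k$, either there exists a collection of $k$ vertex-disjoint and pairwise anticomplete $(A,B)$-paths in $G$, or there exists an $(A,B)$-separator in $G$ of size at most $k \cdot h(H)$.
   Context: Graphs are finite and simple. $G$ contains $H$ as a topological minor if $H$ can be obtained from a subgraph of $G$ by repeatedly contracting edges incident to vertices of degree $2$. A path is a non-empty sequence $v_1,\ldots,v_\ell$ of distinct vertices in which consecutive vertices are adjacent; it is an $(A,B)$-path if $v_1 \in A$ and $v_\ell \in B$. Two paths are anticomplete if there is no edge between a vertex of one and a vertex of the other. A set $S \subseteq V(G)$ is an $(A,B)$-separator if every $(A,B)$-path contains a vertex of $S$. *)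

(* Defs.v *)
From mathcomp Require Import all_boot.

Set Implicit Arguments.
Unset Strict Implicit.
Unset Printing Implicit Defensive.

Record sgraph := SGraph {
  vertex :> finType;
  edge : rel vertex;
  edge_sym : symmetric edge;
  edge_irrefl : irreflexive edge }.

Definition degree (G : sgraph) (v : G) : nat := #|[set w | edge v w]|.

Definition isomorphic (F H : sgraph) : Prop :=
  exists2 f : F -> H, bijective f & {mono f : u v / edge u v}.

(* F is isomorphic to a (not necessarily induced) subgraph of G. *)
Definition subgraph (F G : sgraph) : Prop :=
  exists2 f : F -> G, injective f & {homo f : u v / edge u v}.

Section Contraction.
Variables (G : sgraph) (x y : G).

(* When xy is an edge, this is G / xy: the vertex y is removed and x stands for
   the vertex obtained by identifying x and y; loops and parallel edges are
   discarded. *)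
Definition contract_edge : rel {z : G | z != y} :=
  fun u v => (u != v) &&
    [|| edge (val u) (val v),
        (val u == x) && edge y (val v)
      | (val v == x) && edge (val u) y].

Lemma contract_edge_sym : symmetric contract_edge.
Proof.
move=> u v; rewrite /contract_edge eq_sym (edge_sym (val v)) (edge_sym y (val v)).
by rewrite (edge_sym y (val u)) [X in _ = _ && (_ || X)]orbC.
Qed.

Lemma contract_edge_irrefl : irreflexive contract_edge.
Proof. by move=> u; rewrite /contract_edge eqxx. Qed.

Definition contract : sgraph := SGraph contract_edge_sym contract_edge_irrefl.
End Contraction.

(* H is, up to isomorphism, obtained from F by repeatedly contracting edges
   incident to vertices of degree 2 (the degree being taken in the current
   graph). *)
Inductive deg2_contracts_to : sgraph -> sgraph -> Prop :=
| Deg2ContractsDone (F H : sgraph) :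
    isomorphic F H -> deg2_contracts_to F H
| Deg2ContractsStep (F : sgraph) (x y : F) (H : sgraph) :
    edge x y -> degree x = 2 \/ degree y = 2 ->
    deg2_contracts_to (contract x y) H -> deg2_contracts_to F H.

Definition topological_minor (H G : sgraph) : Prop :=
  exists2 F : sgraph, subgraph F G & deg2_contracts_to F H.

Section Paths.
Variables (G : sgraph) (A B : {set G}).

Definition AB_path (p : seq G) : bool :=
  if p is x :: s then [&& uniq p, path (@edge G) x s, x \in A & last x s \in B]
  else false.

Definition AB_separator (S : {set G}) : Prop :=
  forall p : seq G, AB_path p -> exists2 v, v \in p & v \in S.
End Paths.

Definition vertex_disjoint (G : sgraph) (p q : seq G) : Prop :=
  forall v, v \in p -> v \notin q.

Definition anticomplete (G : sgraph) (p q : seq G) : Prop :=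
  forall u v, u \in p -> v \in q -> ~~ edge u v.

(* Main.v *)
Require Import Defs.
From mathcomp Require Import all_boot.
From mathcomp Require Import zify.

Set Implicit Arguments.
Unset Strict Implicit.
Unset Printing Implicit Defensive.

(** Start from a large family of disjoint (A,B)-paths and work inside their
    union U.  Contracting pairwise disjoint stars, each touched by at most D of
    the paths, and applying Menger's theorem to the quotient costs a factor D and
    yields induced paths in U, no two of which touch the same star.  On a
    shortest path every vertex v satisfies
    deg v + [v in A] + [v in B] = 2, so afterwards the centre of a star
    has at most two neighbours in its star, and this survives further rounds.

    Excluding a topological minor is used twice.  First, only a small fraction
    of the paths contains a vertex touching many paths: otherwise the paths,
    cut into short connected pieces, would join such vertices into a dense
    topological minor, against Mader's theorem.  Second, there is a vertex
    ordering with few earlier neighbours, and a bounded colouring for which the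
    stars formed by equally coloured vertices and their later neighbours are
    disjoint.  One round per colour bounds the degrees in U; then one round per
    colour of the square of G[U], with full neighbourhoods as stars, makes
    deg v + [v in A] + [v in B] <= 2 hold in all of U, which leaves no room for
    an edge between two paths. *)

(** * Topological minors and closed graph classes *)

Lemma isomorphic_trans F G H : isomorphic F G -> isomorphic G H -> isomorphic F H.
Proof.
move=> [f bf mf] [g bg mg]; exists (g \o f); first exact: bij_comp.
by move=> u v /=; rewrite mg mf.
Qed.

Lemma isomorphic_sym F G : isomorphic F G -> isomorphic G F.
Proof.
move=> [f [g fK gK] mf]; exists g; first by exists f.
by move=> u v; rewrite -mf !gK.
Qed.

Lemma isomorphic_degree (F G : sgraph) (f : F -> G) u :
  bijective f -> {mono f : u v / edge u v} -> degree (f u) = degree u.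
Proof.
move=> [g fK gK] mf; rewrite /degree -(card_imset _ (can_inj fK)).
apply: eq_card => w; rewrite inE -{1}(gK w) mf.
by apply/idP/imsetP=> [uw | [z]]; [exists (g w); rewrite ?inE ?gK | rewrite inE => uz ->; rewrite fK].
Qed.

Lemma isomorphic_contract (F G : sgraph) (f : F -> G) x y :
  bijective f -> {mono f : u v / edge u v} ->
  isomorphic (contract x y) (contract (f x) (f y)).
Proof.
move=> [g fK gK] mf.
have fne (z : {z : F | z != y}) : f (val z) != f y.
  by rewrite (inj_eq (can_inj fK)) (valP z).
have gne (z : {z : G | z != f y}) : g (val z) != y.
  by rewrite -(inj_eq (can_inj fK)) gK (valP z).
exists ((fun z => exist _ (f (val z)) (fne z)) : contract x y -> contract (f x) (f y)).
  exists (fun z => exist _ (g (val z)) (gne z)) => z; apply: val_inj => /=.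
    by rewrite fK.
  by rewrite gK.
move=> u v; rewrite /edge /= /contract_edge /= !mf !(inj_eq (can_inj fK)).
congr (_ && _); rewrite -(inj_eq val_inj) /= (inj_eq (can_inj fK)).
by rewrite (inj_eq val_inj).
Qed.

(** Contracting a subdivided edge returns the original graph only up to isomorphism, so contraction
    sequences have to be transported along isomorphisms. *)
Lemma deg2_contracts_iso F F' H :
  isomorphic F' F -> deg2_contracts_to F H -> deg2_contracts_to F' H.
Proof.
move=> iso c; elim: c F' iso => {F H} [F H FH F' iso | F x y H xy dxy _ IH F' iso].
  by apply: Deg2ContractsDone; apply: isomorphic_trans iso FH.
have [f [g fK gK] mf] := iso; have bf : bijective f by exists g.
apply: (@Deg2ContractsStep F' (g x) (g y)).
- by rewrite -mf !gK.
- by rewrite -!(isomorphic_degree _ bf mf) !gK.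
- by apply: IH; rewrite -{2}(gK x) -{2}(gK y); apply: isomorphic_contract.
Qed.

Lemma subgraph_trans F G H : subgraph F G -> subgraph G H -> subgraph F H.
Proof.
move=> [f fi fh] [g gi gh]; exists (g \o f); first exact: inj_comp.
by move=> u v /fh/gh.
Qed.

Lemma topological_minor_subgraph H F G :
  subgraph F G -> topological_minor H F -> topological_minor H G.
Proof. by move=> FG [K KF KH]; exists K => //; apply: subgraph_trans FG. Qed.

Lemma subgraph_topological_minor H G : subgraph H G -> topological_minor H G.
Proof.
move=> HG; exists H => //; apply: Deg2ContractsDone.
by exists id => //; exists id.
Qed.

Section Subdivide.
Variables (F : sgraph) (a b : F).
Hypothesis ab : edge a b.

Definition same_pair (T : eqType) (a b x y : T) :=
  ((x == a) && (y == b)) || ((x == b) && (y == a)).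

(** [None] is the new vertex placed on the edge between [a] and [b]. *)
Definition subdiv_edge : rel (option F) := fun u v =>
  match u, v with
  | Some x, Some y => edge x y && ~~ same_pair a b x y
  | Some x, None | None, Some x => (x == a) || (x == b)
  | None, None => false
  end.

Lemma subdiv_edge_sym : symmetric subdiv_edge.
Proof.
case=> [x|] [y|] //=; rewrite edge_sym /same_pair orbC.
by rewrite ![(y == _) && _]andbC.
Qed.

Lemma subdiv_edge_irrefl : irreflexive subdiv_edge.
Proof. by case=> [x|] //=; rewrite edge_irrefl. Qed.

Definition subdivide : sgraph := SGraph subdiv_edge_sym subdiv_edge_irrefl.

Let nab : a != b.
Proof. by apply/eqP=> E; move: ab; rewrite E edge_irrefl. Qed.

(** [None] has degree 2, and contracting its edge to [Some a] restores the edge between [a] and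
    [b]. *)
Lemma subdivide_contracts H :
  deg2_contracts_to F H -> deg2_contracts_to subdivide H.
Proof.
move=> FH; apply: (@Deg2ContractsStep subdivide (Some a) None).
- by rewrite /edge /= eqxx.
- right; rewrite /degree.
  have -> : [set w | @edge subdivide None w] = [set Some a; Some b].
    by apply/setP=> -[x|]; rewrite !inE.
  by rewrite cards2 (inj_eq Some_inj) nab.
apply: deg2_contracts_iso FH; apply: isomorphic_sym.
have sn (x : F) : Some x != None by [].
exists ((fun x => exist _ (Some x) (sn x)) : F -> contract (Some a : subdivide) None).
  (* The default [a] is never reached, since [None] is the vertex removed by the contraction. *)
  exists (fun z : {z : option F | z != None} => odflt a (val z)) => //.
  by move=> [[z|] iz] //; apply: (@val_inj _ _ {z : option F | z != None}).
move=> x y; rewrite [LHS]/= /contract_edge -(inj_eq val_inj) /= !(inj_eq Some_inj).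
rewrite /same_pair.
have [->|nxy] := eqVneq x y; first by rewrite edge_irrefl.
have [xa|nxa] := eqVneq x a; have [ya|nya] := eqVneq y a; subst => //=.
- by rewrite eqxx in nxy.
- have [yb|nyb] := eqVneq y b; subst; rewrite ?(negPf nab) ?andbF ?orbF ?orbT ?andbT //=.
- have [xb|nxb] := eqVneq x b; subst; rewrite ?(negPf nab) ?andbF ?orbF ?orbT ?andbT //=.
  by rewrite edge_sym ab.
- by rewrite ?andbF ?andbT ?orbF.
Qed.
End Subdivide.

Section Class.
Variable T : finType.

(* Symmetrised and loopless, so that [ind S e] is a graph for every [e]. *)
Definition ind_edge (S : {set T}) (e : rel T) : rel {x : T | x \in S} :=
  fun x y => (val x != val y) && (e (val x) (val y) || e (val y) (val x)).

Lemma ind_edge_sym S e : symmetric (@ind_edge S e).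
Proof. by move=> x y; rewrite /ind_edge eq_sym orbC. Qed.

Lemma ind_edge_irrefl S e : irreflexive (@ind_edge S e).
Proof. by move=> x; rewrite /ind_edge eqxx. Qed.

Definition ind S e : sgraph := SGraph (@ind_edge_sym S e) (@ind_edge_irrefl S e).

Definition add_edge (v w : T) (e : rel T) : rel T :=
  [rel x y | e x y || same_pair v w x y].

(** Together with [clique_free], this is what the argument retains of excluding a topological minor:
    closure under subgraphs and under replacing a path [v u w] by an edge [v w]. The class is kept
    abstract because Mader's induction changes it, from [C] to [link_class] over [C]. *)
Record closed_class (C : {set T} -> rel T -> Prop) := ClosedClass {
  class_sym : forall S e, C S e -> symmetric e;
  class_irr : forall S e, C S e -> irreflexive e;
  class_sub : forall (S S' : {set T}) (e e' : rel T), C S e -> S' \subset S ->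
    symmetric e' -> irreflexive e' -> {in S' &, subrel e' e} -> C S' e';
  class_suppress : forall (S : {set T}) (e : rel T) u v w, C S e ->
    u \in S -> v \in S -> w \in S -> v != w -> e u v -> e u w ->
    C (S :\ u) (add_edge v w e) }.

Definition clique_free r (C : {set T} -> rel T -> Prop) :=
  forall (S R : {set T}) (e : rel T), C S e -> R \subset S ->
    {in R &, forall x y, x != y -> e x y} -> #|R| < r.

Definition tm_free H (S : {set T}) (e : rel T) :=
  [/\ symmetric e, irreflexive e & ~ topological_minor H (ind S e)].

Lemma add_edge_sym v w e : symmetric e -> symmetric (add_edge v w e).
Proof.
move=> se x y; rewrite /add_edge /same_pair /= se orbC [RHS]orbC; congr (_ || _).
by rewrite orbC andbC [X in _ || X]andbC.
Qed.

Lemma add_edge_irr v w e : v != w -> irreflexive e -> irreflexive (add_edge v w e).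
Proof.
move=> nvw ie x; rewrite /add_edge /same_pair /= ie /=.
by apply/norP; split; apply: contra nvw => /andP[/eqP<- /eqP<-].
Qed.

Lemma ind_subgraph (S S' : {set T}) (e e' : rel T) : S' \subset S -> {in S' &, subrel e' e} ->
  subgraph (ind S' e') (ind S e).
Proof.
move=> /subsetP sS se.
exists (fun x : {x | x \in S'} => exist (fun x => x \in S) (val x) (sS _ (valP x))).
  by move=> x y [/val_inj].
move=> x y; rewrite /edge /= /ind_edge /= => /andP[-> /orP[]/se->] //.
  exact: valP. exact: valP. by rewrite orbT. exact: valP. exact: valP.
Qed.

(** If the embedding of [F] sends an edge to the pair [v], [w], that edge is subdivided and the new
    vertex is sent to [u]; by [subdivide_contracts] the subdivision still contracts to [H].
    Otherwise the same embedding avoids the added edge. *)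
Lemma topological_minor_suppress H (S : {set T}) (e : rel T) u v w :
  symmetric e -> u \in S -> v \in S -> w \in S -> v != w -> u != v -> u != w ->
  e u v -> e u w ->
  topological_minor H (ind (S :\ u) (add_edge v w e)) ->
  topological_minor H (ind S e).
Proof.
move=> se uS vS wS vw uv uw euv euw [F [f fi fh] FH].
have [k [ki kS ku kh]] : exists k : F -> T, [/\ injective k, forall x, k x \in S,
    forall x, k x != u & forall x y, edge x y ->
      k x != k y /\ (e (k x) (k y) \/ same_pair v w (k x) (k y))].
  exists (fun x => val (f x)); split=> [x y /val_inj/fi //|x|x|x y /fh].
  - by have := valP (f x); rewrite inE => /andP[].
  - by have := valP (f x); rewrite !inE => /andP[].
  rewrite /edge /= /ind_edge => /andP[-> E]; split=> //.
  by move: E; rewrite [X in _ || X]add_edge_sym // orbb => /orP[]; [left | right].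
have [[a b] /= /and3P[ab /eqP ka /eqP kb] | noab] :=
    pickP [pred c : F * F | [&& edge c.1 c.2, k c.1 == v & k c.2 == w]].
  exists (subdivide a b); last exact: subdivide_contracts.
  pose g (z : subdivide a b) : ind S e :=
    if z is Some x then exist _ (k x) (kS x) else exist _ u uS.
  exists g.
    move=> [x|] [y|] //= /(congr1 val) /= E; first by congr Some; apply: ki.
      by have := ku x; rewrite E eqxx.
    by have := ku y; rewrite -E eqxx.
  move=> [x|] [y|] //; rewrite [X in is_true X -> _]/= [X in _ -> is_true X]/= /ind_edge /=.
  - case/andP=> /kh[-> exy] nab; case: exy => [-> //| sp].
    by case/negP: nab; move: sp; rewrite /same_pair -ka -kb !(inj_eq ki).
  - by rewrite ku /= => /orP[]/eqP->; rewrite ?ka ?kb ?euv ?euw orbT.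
  - by rewrite [u == _]eq_sym ku /= => /orP[]/eqP->; rewrite ?ka ?kb ?euv ?euw.
exists F => //; exists (fun x => exist _ (k x) (kS x) : ind S e).
  by move=> x y /(congr1 val) /ki.
move=> x y exy; have [nxy exy'] := kh _ _ exy; rewrite /= /ind_edge /= nxy /=.
case: exy' => [-> // | /orP[]/andP[/eqP fx /eqP fy]].
  by have := noab (x, y); rewrite /= exy fx fy !eqxx.
by have := noab (y, x); rewrite /= edge_sym exy fx fy !eqxx.
Qed.

Lemma tm_free_closed (H : sgraph) : closed_class (tm_free H).
Proof.
split=> [S e [] //|S e [] //|S S' e e' [se ie nt] sS se' ie' sub
        |S e u v w [se ie nt] uS vS wS vw euv euw].
- by split=> // /(topological_minor_subgraph (ind_subgraph sS sub)).
- split; [exact: add_edge_sym|exact: add_edge_irr|].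
  have nu x : e u x -> u != x by apply: contraTneq => <-; rewrite ie.
  by move/topological_minor_suppress => /(_ se uS vS wS vw (nu _ euv) (nu _ euw) euv euw).
Qed.

(** A clique on more than [#|H|] vertices contains [H] as a subgraph. The parameter [#|H|.+1] is
    positive also when [H] is empty. *)
Lemma tm_free_clique_free (H : sgraph) : clique_free #|H|.+1 (tm_free H).
Proof.
move=> S R e [se ie nt] sRS cl.
rewrite ltnS leqNgt; apply/negP=> ltHR; apply: nt; apply: subgraph_topological_minor.
pose g (x : H) := enum_val (widen_ord (ltnW ltHR) (enum_rank x)).
have gR x : g x \in R by apply: enum_valP.
exists (fun x => exist _ (g x) (subsetP sRS _ (gR x)) : ind S e).
  move=> x y /(congr1 val) /= /enum_val_inj /(congr1 val) /= /val_inj.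
  exact: enum_rank_inj.
move=> x y xy; rewrite /edge /= /ind_edge /=.
have nxy : g x != g y.
  apply: contraTneq xy => /enum_val_inj /(congr1 val) /= /val_inj /enum_rank_inj ->.
  by rewrite edge_irrefl.
by rewrite nxy cl.
Qed.
End Class.

(** * Mader's linear bound *)

Section Sparse.
Variable T : finType.
Implicit Types (e f : rel T) (S U W X Y R : {set T}) (x y z : T).

Definition nbh e S x := [set y in S | e x y].
(** Ordered pairs are counted, so for a graph this is twice the number of edges, or the sum of the
    degrees. *)
Definition arcs e S := #|[set p in setX S S | e p.1 p.2]|.
Definition nbhs e X Y := [set x in X | [exists y in Y, e x y]].
Definition restr e Y : rel T := [rel x y | [&& x \in Y, y \in Y & e x y]].
Definition conn e Y := {in Y &, forall x y, connect (restr e Y) x y}.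

Lemma nbhsP e X Y x :
  reflect (x \in X /\ exists2 y, y \in Y & e x y) (x \in nbhs e X Y).
Proof.
rewrite inE; apply: (iffP andP) => -[xX].
  by case/existsP=> y /andP[yY exy]; split=> //; exists y.
by case=> y yY exy; split=> //; apply/existsP; exists y; rewrite yY.
Qed.

Lemma arcsE e S : arcs e S = \sum_(x in S) #|nbh e S x|.
Proof.
rewrite /arcs -sum1_card.
under [RHS]eq_bigr do rewrite -sum1_card.
rewrite pair_big_dep /=; apply: eq_bigl => -[x y].
by rewrite !inE /= andbA.
Qed.

Lemma sum_nbh_sub e S (Z : {set T}) : Z \subset S ->
  \sum_(z in Z) #|nbh e S z| <= arcs e S.
Proof.
move=> sZ; rewrite arcsE [leqRHS](big_setID Z) /= (setIidPr sZ); exact: leq_addr.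
Qed.

Lemma subset_of_size (S : {set T}) n : n <= #|S| -> exists2 R : {set T}, R \subset S & #|R| = n.
Proof.
case/card_geqP=> s [us <- sS]; exists [set x in s].
  by apply/subsetP=> x; rewrite inE => /sS.
by rewrite cardsE; apply/card_uniqP.
Qed.

Lemma arcs_del e S w : symmetric e -> irreflexive e -> w \in S ->
  arcs e S = arcs e (S :\ w) + 2 * #|nbh e (S :\ w) w|.
Proof.
move=> se ie wS; rewrite !arcsE (big_setD1 w) //=.
have -> : nbh e S w = nbh e (S :\ w) w.
  by apply/setP=> y; rewrite !inE; case: eqP => // ->; rewrite ie andbF.
rewrite addnC mul2n -addnn addnA; congr (_ + _).
have -> : #|nbh e (S :\ w) w| = \sum_(x in S :\ w) e w x.
  rewrite -sum1_card big_mkcond [RHS]big_mkcond; apply: eq_bigr => x _.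
  by rewrite inE; case: (x \in _); case: (e w x).
rewrite -big_split /=; apply: eq_bigr => x xS.
rewrite (cardsD1 w) !inE wS /= addnC se; congr (_ + _).
apply: eq_card => y; rewrite !inE.
by case: (y == w).
Qed.

Lemma restr_sym e Y : symmetric e -> symmetric (restr e Y).
Proof. by move=> se x y; rewrite /restr /= se andbCA. Qed.

Lemma restr_mono e X Y : X \subset Y -> subrel (restr e X) (restr e Y).
Proof. by move=> /subsetP sXY x y /and3P[/sXY xY /sXY yY exy]; apply/and3P. Qed.

Lemma connect_restr_mono e X Y : X \subset Y ->
  subrel (connect (restr e X)) (connect (restr e Y)).
Proof.
by move=> sXY; apply: connect_sub => x y /(restr_mono sXY) xy; apply: connect1.
Qed.

Lemma conn_center e Y u : symmetric e ->
  (forall x, x \in Y -> connect (restr e Y) x u) -> conn e Y.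
Proof.
move=> se Yu x y /Yu xu /Yu yu; apply: connect_trans xu _.
by rewrite sym_connect_sym //; apply: restr_sym.
Qed.

Lemma conn_add e Y w u : symmetric e -> conn e Y -> u \in Y -> e w u -> conn e (w |: Y).
Proof.
move=> se cY uY ewu; apply: (@conn_center _ _ u) => // x.
rewrite in_setU1 => /orP[/eqP-> | xY].
  by apply: connect1; rewrite /restr /= !inE eqxx uY orbT.
by apply: connect_restr_mono (cY _ _ xY uY); apply: subsetUr.
Qed.

Lemma conn1 e x : conn e [set x].
Proof. by move=> a b; rewrite !inE => /eqP-> /eqP->. Qed.

Lemma arcs0 e : arcs e set0 = 0.
Proof. by rewrite arcsE big_set0. Qed.

(* Mader: contract a maximal connected set [U] that keeps the average degree at
   least [2 * D]; contracting one more neighbour must then destroy more than [D]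
   edges, which lie in the neighbourhood [W] of [U]. *)
Lemma dense_neighbourhood e S D : symmetric e -> irreflexive e -> 0 < D ->
  S != set0 -> 2 * D * #|S| <= arcs e S ->
  exists U W : {set T}, [/\ U \subset S /\ W \subset S, [disjoint U & W],
    conn e U, forall w, w \in W -> exists2 u, u \in U & e w u &
    W != set0 /\ D * #|W| <= arcs e W].
Proof.
move=> se ie D0; have [n] := ubnP #|S|; elim: n S => // n IH S leS S0 dS.
(* The last inequality is the density condition in the graph where [U] is contracted to one vertex:
   [.+1] counts that vertex and [nbhs] its edges. *)
pose P (U : {set T}) := [&& U \subset S, U != set0,
  [forall x in U, forall y in U, connect (restr e U) x y] &
  2 * D * #|S :\: U|.+1 <= arcs e (S :\: U) + 2 * #|nbhs e (S :\: U) U|].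
have /ex_maxset[U /maxsetP[/and4P[sU U0 cU dU] maxU]] : exists U, P U.
  have [x xS] := set0Pn _ S0; exists [set x]; apply/and4P; split.
  - by rewrite sub1set.
  - by apply/set0Pn; exists x; rewrite inE.
  - by apply/forall_inP=> a aU; apply/forall_inP=> b bU; apply: conn1.
  have -> : nbhs e (S :\ x) [set x] = nbh e (S :\ x) x.
    apply/setP=> y; apply/nbhsP/idP => [[yS [z]] | ].
      by rewrite !inE => /eqP-> yx; move: yS; rewrite !inE => ->; rewrite se.
    rewrite inE => /andP[yS xy]; split=> //; exists x; rewrite ?inE // se //.
  rewrite -arcs_del //; move: dS; rewrite (cardsD1 x) xS; lia.
have {}cU : conn e U by move=> a b aU bU; move/forall_inP/(_ _ aU)/forall_inP: cU; apply.
set Q := S :\: U; set W := nbhs e Q U; rewrite -/Q -/W in dU.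
have sQS : Q \subset S by apply: subsetDl.
(* If nothing outside [U] is adjacent to [U], all arcs lie in [Q], and the induction applies to
   [Q]. *)
have [W0 | W0] := eqVneq W set0.
  rewrite W0 cards0 muln0 addn0 in dU.
  have Q0 : Q != set0.
    by apply/eqP=> Q0; move: dU; rewrite Q0 arcs0 cards0; lia.
  have ltQ : #|Q| < n.
    suff : #|Q| < #|S| by move: leS; lia.
    rewrite proper_card // properEneq sQS andbT.
    apply: contraNneq U0 => QS; move: sU; rewrite -QS => sU.
    by rewrite -subset0 -(setDv U) -/Q; apply/subsetP=> z zU; have := subsetP sU z zU;
       rewrite !inE zU.
  have [|U' [W' [[sU' sW'] dis c' n' d']]] := IH Q ltQ Q0; first by move: dU; lia.
  by exists U', W'; split=> //; split; apply: subset_trans sQS.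
exists U, W; split=> //.
- by split=> //; apply: subset_trans sQS; apply/subsetP=> z; rewrite inE => /andP[].
- rewrite disjoint_sym; apply/pred0P=> z /=; rewrite !inE.
  by case: (z \in U); rewrite ?andbF.
- by move=> w /nbhsP[].
split=> //; rewrite arcsE mulnC -sum_nat_const; apply: leq_sum => w wW.
have [wQ [u uU ewu]] := nbhsP _ _ _ _ wW.
have wU : w \notin U by move: wQ; rewrite inE => /andP[].
have wS : w \in S by apply: (subsetP sQS).
(* If [w] has fewer than [D] neighbours in [W], absorbing it into [U] loses one vertex and at most
   [D] edges, against maximality: the edge to [w] disappears, and one edge merges for each common
   neighbour. *)
rewrite leqNgt; apply/negP=> ltw.
suff /maxU/(_ (subsetUr _ _)) E : P (w |: U) by move: wU; rewrite -E setU11.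
have EQ : S :\: (w |: U) = Q :\ w.
  by apply/setP=> z; rewrite !inE negb_or -andbA.
apply/and4P; split; rewrite ?EQ.
- by rewrite subUset sub1set wS.
- by apply/set0Pn; exists w; rewrite setU11.
- by apply/forall_inP=> a aU; apply/forall_inP=> b bU; apply: (conn_add se cU uU ewu).
have cQ : #|Q| = #|Q :\ w|.+1 by rewrite (cardsD1 w) wQ.
have aQ := arcs_del se ie wQ.
have EN : nbhs e (Q :\ w) (w |: U) = (W :\ w) :|: nbh e (Q :\ w) w.
  apply/setP=> z; apply/nbhsP/idP => [[zQ [v]] | ].
    rewrite in_setU1 => /orP[/eqP-> zw | vU zv].
      by rewrite in_setU inE [X in _ || X]inE zQ se zw orbT.
    rewrite in_setU in_setD1; move: (zQ); rewrite in_setD1 => /andP[-> zQ'].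
    by apply/orP; left; apply/nbhsP; split=> //; exists v.
  rewrite in_setU in_setD1 [z \in nbh _ _ _]inE => /orP[/andP[zw /nbhsP[zQ [v vU zv]]] | /andP[zQ wz]].
    by split; [rewrite in_setD1 zw | exists v => //; rewrite in_setU1 vU orbT].
  by split=> //; exists w; rewrite ?setU11 // se.
have EI : (W :\ w) :&: nbh e (Q :\ w) w = nbh e W w.
  apply/setP=> z; rewrite !inE.
  have [->|_] := eqVneq z w; first by rewrite ie !andbF.
  by case: (z \in U); case: (z \in S); case: (e w z); rewrite ?andbF ?andbT.
have cW : #|W| = #|W :\ w|.+1 by rewrite (cardsD1 w) wW.
have := cardsUI (W :\ w) (nbh e (Q :\ w) w); rewrite -EN EI.
move: dU ltw; rewrite cQ aQ cW.
set a := arcs _ _; set b := #|nbh e (Q :\ w) w|; set c := #|nbh e W w|.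
set d := #|W :\ w|; set m := #|Q :\ w|; set k := #|nbhs _ _ _|.
by clearbody a b c d m k; clear; nia.
Qed.

Section Closed.
Variable C : {set T} -> rel T -> Prop.
Hypothesis cC : closed_class C.

Lemma class_restrict S S' e : C S e -> S' \subset S -> C S' e.
Proof.
move=> CS sS; apply: (class_sub cC CS sS); first exact: class_sym CS.
  exact: class_irr CS.
by [].
Qed.

(** The inner vertices are suppressed one after another: suppressing [u] turns [x u u'] into an edge
    [x u'], so [x] stays an end and the path shortens. *)
Lemma class_suppress_path S e x y u s : C S e -> x \in S -> y \in S -> x != y ->
  x \notin u :: s -> y \notin u :: s -> {subset u :: s <= S} -> uniq (u :: s) ->
  path e u s -> e x u -> e (last u s) y -> C (S :\: [set z in u :: s]) (add_edge x y e).
Proof.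
elim: s S e u => [|u' s IH] S e u CS xS yS nxy xs ys sS us pu exu ey.
  have -> : S :\: [set z in [:: u]] = S :\ u by apply/setP=> z; rewrite !inE.
  apply: (class_suppress cC CS) => //; first by apply: sS; rewrite inE.
  by rewrite (class_sym cC CS).
have se := class_sym cC CS.
have [ns us'] : u \notin u' :: s /\ uniq (u' :: s) by case/andP: us.
move: pu; rewrite [path _ _ _]/= => /andP[euu' pu].
have CS1 : C (S :\ u) (add_edge x u' e).
  apply: (class_suppress cC CS) => //; rewrite 1?se //.
  - by apply: sS; rewrite inE eqxx.
  - by apply: sS; rewrite !inE eqxx orbT.
  - by apply: contraNneq xs => ->; rewrite !inE eqxx orbT.
have [xu {}xs] : x != u /\ x \notin u' :: s by apply/norP; rewrite -in_cons.
have [yu {}ys] : y != u /\ y \notin u' :: s by apply/norP; rewrite -in_cons.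
have CS2 : C (S :\ u :\: [set z in u' :: s]) (add_edge x y (add_edge x u' e)).
  apply: IH => //.
  - by rewrite !inE xu.
  - by rewrite !inE yu.
  - move=> z zs; apply/setD1P; split; first by apply: contraTneq zs => ->.
    by apply: sS; rewrite in_cons zs orbT.
  - by apply: sub_path pu => a b ab; rewrite /add_edge /= ab.
  - by rewrite /add_edge /same_pair /= !eqxx orbT.
  - by move: ey; rewrite /add_edge /= => ->.
apply: (class_sub cC CS2).
- by apply/subsetP=> z; rewrite !inE negb_or -andbA => /and3P[-> -> ->].
- exact: add_edge_sym.
- exact/add_edge_irr/(class_irr cC CS).
- by move=> a b _ _; rewrite /add_edge /= => /orP[]->; rewrite ?orbT.
Qed.

(** A connected set can be spent on one new edge between two of its neighbours: a simple path
    through [U] is suppressed and the rest of [U] is deleted. *)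
Lemma class_contract S U e x y : C S e -> U \subset S -> conn e U ->
  x \in S :\: U -> y \in S :\: U -> x != y ->
  x \in nbhs e S U -> y \in nbhs e S U -> C (S :\: U) (add_edge x y e).
Proof.
move=> CS /subsetP sU cU xS yS nxy /nbhsP[_ [u uU exu]] /nbhsP[_ [v vU eyv]].
have se := class_sym cC CS.
have /connectP[p pp lp] := cU _ _ uU vU.
case/shortenP: pp lp => q pq uq _ Ev.
have qU : {subset u :: q <= U}.
  move=> z; rewrite inE => /orP[/eqP->//|].
  elim: (q) (u) pq => //= b q' IH a /andP[/and3P[_ bU _] pq].
  by rewrite inE => /orP[/eqP->//|]; apply: IH pq.
move: xS yS; rewrite !in_setD => /andP[xU xS] /andP[yU yS].
have CS1 : C (S :\: [set z in u :: q]) (add_edge x y e).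
  apply: class_suppress_path => //.
  - by apply: contra xU => /qU.
  - by apply: contra yU => /qU.
  - by move=> z /qU/sU.
  - by apply: sub_path pq => a b /and3P[].
  - by rewrite -Ev se.
apply: class_restrict CS1 _; apply/subsetP=> z; rewrite !in_setD => /andP[zU ->].
by rewrite andbT inE; apply: contra zU => /qU.
Qed.
End Closed.

Definition glue U e f : rel T :=
  [rel x y | if (x \in U) || (y \in U) then e x y else f x y].

(* Graphs on part of [W] that stay in [C] when [U] and its edges are put back. *)
Definition link_class (C : {set T} -> rel T -> Prop) U W e (S : {set T}) f :=
  [/\ symmetric f, irreflexive f, S \subset W & C (S :|: U) (glue U e f)].

Lemma glue_sym U e f : symmetric e -> symmetric f -> symmetric (glue U e f).
Proof. by move=> se sf x y; rewrite /glue /= orbC se sf. Qed.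

Lemma glue_irr U e f : irreflexive e -> irreflexive f -> irreflexive (glue U e f).
Proof. by move=> ie jf x; rewrite /glue /= ie jf if_same. Qed.

(** Deletions and suppressions inside [W] leave [U] and its edges intact, so [U] remains available
    for a later contraction. *)
Lemma link_class_closed C U W e : closed_class C -> symmetric e -> irreflexive e ->
  [disjoint U & W] -> closed_class (link_class C U W e).
Proof.
move=> cC se ie dUW.
split=> [S f [] //|S f [] //|S S' f f' [sf jf sS CS] sS' sf' jf' sub
        |S f u v w [sf jf sS CS] uS vS wS vw fuv fuw].
- split=> //; first exact: subset_trans sS.
  apply: (class_sub cC CS); [exact: setSU|exact: glue_sym|exact: glue_irr|].
  move=> x y; rewrite !in_setU /glue /=.
  case: (x \in U); case: (y \in U); rewrite ?orbF //= => xS yS; exact: sub.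
have nU x : x \in S -> x \notin U.
  by move/(subsetP sS) => xW; rewrite (disjointFl dUW xW).
split; [exact: add_edge_sym|exact: add_edge_irr| |].
  by apply: subset_trans sS; apply: subsetDl.
have CS1 : C ((S :|: U) :\ u) (add_edge v w (glue U e f)).
  apply: (class_suppress cC CS); rewrite ?inE ?uS ?vS ?wS //.
    by rewrite /glue /= (negPf (nU _ uS)) (negPf (nU _ vS)).
  by rewrite /glue /= (negPf (nU _ uS)) (negPf (nU _ wS)).
apply: (class_sub cC CS1).
- apply/subsetP=> z; rewrite !inE => /orP[/andP[-> ->] //| zU].
  by rewrite zU orbT andbT; apply: contraTneq zU => ->; apply: nU.
- exact/glue_sym/add_edge_sym.
- exact/glue_irr/add_edge_irr.
by move=> x y _ _; rewrite /glue /add_edge /=; case: ifP => // _ ->.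
Qed.

Lemma arcs_add_edge e S x y : symmetric e -> x \in S -> y \in S -> x != y ->
  ~~ e x y -> (arcs e S).+2 <= arcs (add_edge x y e) S.
Proof.
move=> se xS yS nxy exy; rewrite /arcs.
set E := [set p in _ | e _ _].
have nxE : (x, y) \notin E by rewrite !inE /= (negPf exy) andbF.
have nyE : (y, x) \notin (x, y) |: E.
  by rewrite !inE /= se (negPf exy) andbF orbF xpair_eqE negb_and eq_sym nxy.
have -> : #|E|.+2 = #|(y, x) |: ((x, y) |: E)| by rewrite !cardsU1 nyE nxE.
apply/subset_leq_card/subsetP=> -[a b]; rewrite !inE /= !xpair_eqE.
case/or3P=> [/andP[/eqP-> /eqP->]|/andP[/eqP-> /eqP->]|].
- by rewrite xS yS /add_edge /same_pair /= !eqxx !orbT.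
- by rewrite xS yS /add_edge /same_pair /= !eqxx !orbT.
by case/andP=> -> /=; rewrite /add_edge /= => ->.
Qed.

(* The missing edges of a fixed [r]-set are created one at a time: the recursive
   call runs inside the neighbourhood of a connected [U], and [U] is then used to
   join a non-adjacent pair. *)
Lemma dense_edges r m (C : {set T} -> rel T -> Prop) S e : 0 < r ->
  closed_class C -> C S e -> S != set0 -> 2 ^ m * r * #|S| <= arcs e S ->
  exists S' f (R : {set T}), [/\ C S' f, R \subset S', #|R| = r &
    {in R &, forall x y, x != y -> f x y} \/ 2 * m <= arcs f R].
Proof.
move=> r0; elim: m C S e => [|m IH] C S e cC CS S0 dS.
  (* By averaging some vertex has at least [r] neighbours, which shows that [S] has an [r]-element
     subset. *)
  have [x xS ltx] : exists2 x, x \in S & r <= #|nbh e S x|.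
    apply/exists_inP; rewrite -[X in is_true X]negbK negb_exists_in; apply/negP.
    move/forall_inP=> small; move: dS; rewrite mul1n arcsE mulnC -sum_nat_const leqNgt.
    case/negP; have [x xS] := set0Pn _ S0.
    rewrite (bigD1 x) //= [ltnRHS](bigD1 x) //= -addSn; apply: leq_add.
      by rewrite ltnNge small.
    by apply: leq_sum => y /andP[yS _]; rewrite ltnW // ltnNge small.
  have [|R sR cR] := @subset_of_size S r.
    apply: leq_trans ltx _; apply: subset_leq_card.
    by apply/subsetP=> y; rewrite inE => /andP[].
  by exists S, e, R; split=> //; right.
have se := class_sym cC CS; have ie := class_irr cC CS.
have [||U [W [[sU sW] dUW cU nW [W0 dW]]]] :=
  @dense_neighbourhood e S (2 ^ m * r) se ie _ S0.
- by rewrite muln_gt0 expn_gt0.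
- by move: dS; rewrite expnS; lia.
have cL := link_class_closed cC se ie dUW.
have LW : link_class C U W e W e.
  split=> //; apply: (class_sub cC CS); first by rewrite subUset sW.
  - exact: glue_sym.
  - exact: glue_irr.
  - by move=> x y _ _; rewrite /glue /= if_same.
have [S' [f [R [LS' sR cR H]]]] := IH _ _ _ cL LW W0 dW.
have [sf jf sS'W CS'] := LS'.
have nU x : x \in S' -> x \notin U.
  by move/(subsetP sS'W) => xW; rewrite (disjointFl dUW xW).
have Cf : C S' f.
  apply: (class_sub cC CS') => //; first exact: subsetUl.
  by move=> x y xS yS; rewrite /glue /= (negPf (nU _ xS)) (negPf (nU _ yS)).
case: H => [cl | dR]; first by exists S', f, R; split=> //; left.
have [cl | ] := boolP [forall x in R, forall y in R, (x != y) ==> f x y].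
  exists S', f, R; split=> //; left=> x y xR yR nxy.
  by move/forall_inP/(_ _ xR)/forall_inP/(_ _ yR)/implyP: cl; apply.
rewrite negb_forall_in => /exists_inP[x xR]; rewrite negb_forall_in => /exists_inP[y yR].
rewrite negb_imply => /andP[nxy nfxy].
have xS := subsetP sR _ xR; have yS := subsetP sR _ yR.
have ES : (S' :|: U) :\: U = S'.
  apply/setP=> z; rewrite !inE; case: (boolP (z \in U)) => //= zU; last by rewrite orbF.
  by apply/esym/negP=> /nU; rewrite zU.
have Nx z : z \in S' -> z \in nbhs (glue U e f) (S' :|: U) U.
  move=> zS; apply/nbhsP; split; first by rewrite inE zS.
  have [u uU ezu] := nW _ (subsetP sS'W _ zS).
  by exists u => //; rewrite /glue /= uU orbT.
have : C ((S' :|: U) :\: U) (add_edge x y (glue U e f)).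
  apply: class_contract => //; rewrite ?ES ?subsetUr //; try exact: Nx.
  move=> a b aU bU; apply: connect_sub (cU _ _ aU bU) => c d /and3P[cU' dU' ecd].
  by apply: connect1; apply/and3P; rewrite /glue /= cU'.
rewrite ES => C1; exists S', (add_edge x y f), R; split=> //.
  apply: (class_sub cC C1) => //; [exact: add_edge_sym|exact: add_edge_irr|].
  move=> a b aS bS; rewrite /glue /add_edge /=.
  by rewrite (negPf (nU _ aS)) (negPf (nU _ bS)).
right; apply: leq_trans (arcs_add_edge sf xR yR nxy nfxy).
by rewrite mulnS add2n !ltnS.
Qed.

Lemma arcs_le_sq e S : arcs e S <= #|S| * #|S|.
Proof.
rewrite /arcs -cardsX; apply/subset_leq_card/subsetP=> p.
by rewrite inE => /andP[].
Qed.

(** Each round of [dense_edges] halves the density and gains two arcs. After [r * r] rounds there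
    would be [2 * (r * r)] arcs on [r] vertices, which is too many, so only the clique alternative
    remains. *)
Definition mader r := 2 ^ (r * r) * r.

Theorem mader_bound r (C : {set T} -> rel T -> Prop) S e : 0 < r ->
  closed_class C -> clique_free r C -> C S e -> arcs e S <= mader r * #|S|.
Proof.
move=> r0 cC fC CS.
have [-> | S0] := eqVneq S set0; first by rewrite arcs0.
rewrite leqNgt; apply/negP=> /ltnW dS.
have [S' [f [R [CS' sR cR [cl|dR]]]]] := dense_edges r0 cC CS S0 dS.
  by have := fC _ _ _ CS' sR cl; rewrite cR ltnn.
have := arcs_le_sq f R; rewrite cR; nia.
Qed.
End Sparse.

(** * Disjoint connected pieces, and a vertex ordering *)

Section Pieces.
Variable T : finType.
Implicit Types (e f : rel T) (S U W X Y R : {set T}) (x y z : T).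
Implicit Types (YY Z : {set {set T}}).
Variable C : {set T} -> rel T -> Prop.
Hypothesis cC : closed_class C.

Definition overlay X f e : rel T :=
  [rel x y | if (x \in X) && (y \in X) then f x y else e x y].

Lemma overlay_sym X f e : symmetric f -> symmetric e -> symmetric (overlay X f e).
Proof. by move=> sf se x y; rewrite /overlay /= andbC se sf. Qed.

Lemma overlay_irr X f e : irreflexive f -> irreflexive e -> irreflexive (overlay X f e).
Proof. by move=> jf ie x; rewrite /overlay /= ie jf if_same. Qed.

(* Contract pieces onto missing edges of [X] as long as possible: the pieces in
   [YY'] are used up, and the neighbourhoods of the others are cliques of [f]. *)
Lemma piece_assignment S e X YY : C S e -> X \subset S -> trivIset YY ->
  (forall Y, Y \in YY -> Y \subset S :\: X /\ conn e Y) ->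
  exists f YY', [/\ C X f, YY' \subset YY, 2 * #|YY'| <= arcs f X &
    forall Y, Y \in YY -> Y \notin YY' ->
      {in nbhs e X Y &, forall x y, x != y -> f x y}].
Proof.
move=> CS sX tY YP; have se := class_sym cC CS; have ie := class_irr cC CS.
have YX Y y : Y \in YY -> y \in Y -> y \notin X.
  by case/YP=> /subsetP sY _ /sY; rewrite inE => /andP[].
(* [Z] holds the pieces not yet spent, and every spent piece has paid for one edge of [f], that is,
   two arcs. Initially [f] is empty: the original edges inside [X] are dropped. *)
suff main n Z f : #|Z| <= n -> Z \subset YY -> symmetric f -> irreflexive f ->
    C (X :|: cover Z) (overlay X f e) -> 2 * #|YY :\: Z| <= arcs f X ->
    exists f YY', [/\ C X f, YY' \subset YY, 2 * #|YY'| <= arcs f X &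
      forall Y, Y \in YY -> Y \notin YY' ->
        {in nbhs e X Y &, forall x y, x != y -> f x y}].
  apply: (main #|YY| YY [rel x y | false]) => //; last by rewrite setDv cards0.
  apply: (class_sub cC CS); [|exact: overlay_sym|exact: overlay_irr|].
    rewrite subUset sX /=; apply/bigcupsP=> Y /YP[sY _].
    exact: subset_trans sY (subsetDl _ _).
  by move=> x y _ _; rewrite /overlay /=; case: ifP.
elim: n Z f => [|n IH] Z f leZ sZ sf jf CZ aZ; last first.
  have [/existsP[Y /andP[YZ /existsP[x /existsP[y /and4P[xN yN nxy nf]]]]] | none] :=
    boolP [exists Y, (Y \in Z) && [exists x, exists y,
      [&& x \in nbhs e X Y, y \in nbhs e X Y, x != y & ~~ f x y]]].
    have YYY := subsetP sZ _ YZ; have [sYS cY] := YP _ YYY.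
    have [xX [u uY exu]] := nbhsP _ _ _ _ xN; have [yX [v vY eyv]] := nbhsP _ _ _ _ yN.
    have XY z : z \in X -> z \notin Y by apply: contraTN => /(YX _ _ YYY).
    have C1 : C ((X :|: cover Z) :\: Y) (add_edge x y (overlay X f e)).
      apply: class_contract => //.
      - by apply: subset_trans (subsetUr _ _); apply: bigcup_sup.
      - move=> a b aY bY; apply: connect_sub (cY _ _ aY bY) => c d /and3P[cU dU ecd].
        by apply: connect1; apply/and3P; rewrite /overlay /= (negPf (YX _ _ YYY cU)).
      - by rewrite !inE xX XY.
      - by rewrite !inE yX XY.
      - apply/nbhsP; split; first by rewrite inE xX.
        by exists u => //; rewrite /overlay /= (negPf (YX _ _ YYY uY)) andbF.
      - apply/nbhsP; split; first by rewrite inE yX.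
        by exists v => //; rewrite /overlay /= (negPf (YX _ _ YYY vY)) andbF.
    apply: (IH (Z :\ Y) (add_edge x y f)).
    - by move: leZ; rewrite (cardsD1 Y) YZ.
    - by apply: subset_trans sZ; apply: subsetDl.
    - exact: add_edge_sym.
    - exact: add_edge_irr.
    - apply: (class_sub cC C1).
      + rewrite subUset; apply/andP; split.
          by apply/subsetP=> z zX; rewrite !inE zX XY.
        apply/bigcupsP=> Y' /setD1P[nY' Y'Z]; apply/subsetP=> z zY'.
        rewrite !inE; apply/andP; split.
          apply: contra nY' => zY; apply/eqP/esym.
          by rewrite -(def_pblock tY YYY zY) -(def_pblock tY (subsetP sZ _ Y'Z) zY').
        by apply/orP; right; apply/bigcupP; exists Y'.
      + exact/overlay_sym/se/add_edge_sym.
      + exact/overlay_irr/ie/add_edge_irr.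
      + by move=> a b _ _; rewrite /overlay /add_edge /=; case: ifP => // _ ->.
    have := arcs_add_edge sf xX yX nxy nf.
    have -> : YY :\: (Z :\ Y) = Y |: (YY :\: Z).
      by apply/setP=> W; rewrite !inE; case: eqP => // ->; rewrite YYY.
    rewrite cardsU1 inE YZ /= mulnDr => le_add.
    by apply: leq_trans le_add; rewrite -[(arcs f X).+2]addn2 addnC leq_add2r.
  exists f, (YY :\: Z); split=> //; rewrite ?subsetDl //.
    apply: (class_sub cC CZ) => //; first exact: subsetUl.
    by move=> a b aX bX; rewrite /overlay /= aX bX.
  move=> Y YYY; rewrite inE YYY andbT negbK => YZ x y xN yN nxy.
  apply: contraNT none => nf; apply/existsP; exists Y; rewrite YZ.
  by apply/existsP; exists x; apply/existsP; exists y; rewrite xN yN nxy.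
move: leZ; rewrite leqn0 cards_eq0 => /eqP Z0; rewrite Z0 setD0 in aZ.
exists f, YY; split=> //; last by move=> Y ->.
apply: (class_sub cC CZ) => //; first exact: subsetUl.
by move=> a b aX bX; rewrite /overlay /= aX bX.
Qed.

Section Ordering.
Variables (r : nat) (S : {set T}) (e : rel T).
Hypotheses (r0 : 0 < r) (fC : clique_free r C) (CS : C S e).

Definition back_degree := 4 * mader r.
(** Four times the average degree bound for [later_common], obtained in [good_vertex]. *)
Definition cowidth := 4 * (mader r + mader r * (back_degree * back_degree)).

(** Markov's inequality; a quarter is small enough for two exceptional sets to leave something
    over. *)
Lemma few_rich (I : finType) (A : {set I}) (w : I -> nat) c :
  \sum_(i in A) w i <= c * #|A| -> 4 * #|[set i in A | 4 * c < w i]| <= #|A|.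
Proof.
set Q := [set i in A | _] => le.
have : #|Q| * (4 * c).+1 <= \sum_(i in A) w i.
  have sQ : Q \subset A by apply/subsetP=> i; rewrite inE => /andP[].
  rewrite -sum_nat_const [leqRHS](big_setID Q) /= (setIidPr sQ).
  apply: leq_trans (leq_addr _ _); apply: leq_sum => i.
  by rewrite inE => /andP[].
by move: le; set a := \sum_(i in A) _; nia.
Qed.

Lemma card_bigcup_le (I J : finType) (A : {set I}) (F : I -> {set J}) :
  #|\bigcup_(i in A) F i| <= \sum_(i in A) #|F i|.
Proof.
elim/big_rec2: _ => [|i m X _ le]; first by rewrite cards0.
by apply: leq_trans (leq_card_setU _ _) _; rewrite leq_add2l.
Qed.

(** Ranks are given from the top downwards: [S'] is the part still to be ranked, so [S :\: S']
    consists of the later vertices. *)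
Definition later_common S' : rel T :=
  [rel v w | (v != w) && [exists u in S :\: S', e u v && e u w]].

(** The singletons of the later vertices serve as pieces on [S']. The neighbourhoods of unspent ones
    are cliques of the sparse graph [f]; the spent ones number at most [mader r * #|S'|] and
    contribute at most [back_degree] squared pairs each. Hence [later_common] is sparse, and
    [few_rich] applies to it and to [e]. *)
Lemma good_vertex S' : S' \subset S -> S' != set0 ->
  (forall u, u \in S :\: S' -> #|nbh e S' u| <= back_degree) ->
  exists v, [/\ v \in S', #|nbh e S' v| <= back_degree & #|nbh (later_common S') S' v| <= cowidth].
Proof.
move=> sS' S'0 smallT; set M := mader r.
have se := class_sym cC CS.
have bnd S1 f : C S1 f -> arcs f S1 <= M * #|S1| by apply: mader_bound.
pose YY : {set {set T}} := [set [set u] | u in S :\: S'].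
have tY : trivIset YY.
  apply/trivIsetP=> _ _ /imsetP[u _ ->] /imsetP[v _ ->] nuv.
  by rewrite disjoints1 inE; apply: contra nuv => /eqP->.
have [|f [YY' [Cf sY' aY' clY']]] := piece_assignment CS sS' tY.
  by move=> _ /imsetP[u uS ->]; rewrite sub1set uS; split=> //; apply: conn1.
pose U' := [set u | [set u] \in YY'].
have cU' : #|U'| <= #|YY'|.
  rewrite -(card_imset _ (@set1_inj T)); apply/subset_leq_card/subsetP=> _ /imsetP[u uU ->].
  by move: uU; rewrite inE.
have U'S u : u \in U' -> u \in S :\: S'.
  by rewrite inE => /(subsetP sY') /imsetP[v vS /set1_inj->].
have later_common_le : arcs (later_common S') S' <= arcs f S' + #|U'| * (back_degree * back_degree).
  pose F u := setX (nbh e S' u) (nbh e S' u).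
  apply: leq_trans (_ : #|[set p in setX S' S' | f p.1 p.2] :|: \bigcup_(u in U') F u| <= _).
    apply/subset_leq_card/subsetP=> -[v w]; rewrite !inE /=.
    case/andP=> /andP[vS wS] /andP[nvw /exists_inP[u uS /andP[euv euw]]].
    have [uU | uU] := boolP (u \in U').
      apply/orP; right; apply/bigcupP; exists u => //.
      by rewrite !inE vS wS euv euw.
    rewrite vS wS /=; apply/orP; left.
    have uY : [set u] \in YY by apply/imsetP; exists u.
    have nuY : [set u] \notin YY' by move: uU; rewrite inE.
    by apply: (clY' _ uY nuY) nvw; apply/nbhsP; split=> //; exists u; rewrite ?inE // se.
  apply: leq_trans (leq_card_setU _ _) _; rewrite leq_add2l.
  apply: leq_trans (card_bigcup_le _ _) _; rewrite -sum_nat_const.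
  by apply: leq_sum => u uU; rewrite cardsX leq_mul // smallT // U'S.
pose R1 := [set v in S' | 4 * M < #|nbh e S' v|].
pose R2 := [set v in S' | cowidth < #|nbh (later_common S') S' v|].
have r1 : 4 * #|R1| <= #|S'|.
  by apply: few_rich; rewrite -arcsE; apply: bnd; apply: class_restrict sS'.
have r2 : 4 * #|R2| <= #|S'|.
  apply: few_rich; rewrite -arcsE; apply: leq_trans later_common_le _.
  rewrite mulnDl leq_add ?bnd // mulnAC leq_mul //.
  apply: leq_trans (bnd _ _ Cf); apply: leq_trans cU' _.
  by apply: leq_trans aY'; rewrite leq_pmull.
have S'pos : 0 < #|S'| by rewrite card_gt0.
have : ~~ (S' \subset R1 :|: R2).
  apply/negP=> /subset_leq_card le_S'; have le_R : #|R1 :|: R2| <= #|R1| + #|R2| := leq_card_setU R1 R2.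
  by move: r1 r2 le_S' le_R S'pos; clear; lia.
case/subsetPn=> v vS; rewrite !inE vS /= negb_or -!leqNgt => /andP[d1 d2].
by exists v.
Qed.

Definition ncolors := (back_degree + cowidth).+1.

Lemma fresh_color (R : {set T}) (col : T -> nat) m : #|R| < m ->
  exists2 c, c < m & {in R, forall x, col x != c}.
Proof.
move=> lt; have [m0|] := posnP m; first by rewrite m0 in lt.
case: m lt => // m lt _; pose I := [set (inord (col x) : 'I_m.+1) | x in R].
have /subsetPn[c _ nc] : ~~ ([set: 'I_m.+1] \subset I).
  apply/negP=> /subset_leq_card; rewrite cardsT card_ord leqNgt => /negP[].
  exact: leq_ltn_trans (leq_imset_card _ _) lt.
exists c => // x xR; apply: contraNneq nc => E; apply/imsetP; exists x => //.
by rewrite E inord_val.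
Qed.

Definition star (rk : T -> nat) v := v |: [set u in S | e v u && (rk v < rk u)].

(** A vertex from [good_vertex] becomes the last of [S']. After the rest is coloured, its colour
    avoids those of its neighbours in [S'] and of the vertices sharing a later neighbour with it. In
    the last clause [u \notin S'] stands for being ranked above all of [S']. *)
Lemma rank_coloring_rec S' : S' \subset S ->
  (forall u, u \in S :\: S' -> #|nbh e S' u| <= back_degree) ->
  exists rk col : T -> nat, [/\ forall v, col v < ncolors,
    forall v, v \in S' -> rk v < #|S'|, {in S' &, injective rk},
    forall v, v \in S' -> #|[set w in S' | (rk w < rk v) && e v w]| <= back_degree &
    forall v w, v \in S' -> w \in S' -> rk w < rk v -> col v = col w ->
      ~~ e v w /\ forall u, u \in S -> e u v -> e u w ->
        ~ (u \notin S' \/ rk v < rk u)].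
Proof.
have se := class_sym cC CS; have ie := class_irr cC CS.
have [n] := ubnP #|S'|; elim: n S' => // n IH S' ltS sS' smallT.
have [S'0 | S'0] := eqVneq S' set0.
  by exists (fun=> 0), (fun=> 0); split=> // v; rewrite S'0 inE.
have [v [vS' dv cv]] := good_vertex sS' S'0 smallT.
set S2 := S' :\ v.
have sS2 : S2 \subset S' by apply: subsetDl.
have cS2 : #|S'| = #|S2|.+1 by rewrite (cardsD1 v) vS'.
have nbh_mono u : nbh e S2 u \subset nbh e S' u.
  by apply/subsetP=> z; rewrite !inE => /andP[/andP[_ ->] ->].
have [| |u uS|rk [col [colP rkS rkI rkB rkC]]] := IH S2.
- by move: ltS; rewrite cS2.
- exact: subset_trans sS2 sS'.
- have [->|nuv] := eqVneq u v; first by apply: leq_trans dv; apply: subset_leq_card.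
  apply: leq_trans (smallT u _); first exact: subset_leq_card.
  by move: uS; rewrite !inE nuv.
have [c cm cP] : exists2 c, c < ncolors &
    {in nbh e S' v :|: nbh (later_common S') S' v, forall x, col x != c}.
  apply: fresh_color; apply: leq_ltn_trans (leq_card_setU _ _) _.
  by rewrite /ncolors ltnS leq_add.
pose rk' x := if x == v then #|S2| else rk x.
pose col' x := if x == v then c else col x.
have inS2 x : x \in S' -> x != v -> x \in S2 by move=> xS nx; rewrite !inE nx.
have rkv : rk' v = #|S2| by rewrite /rk' eqxx.
have rkn x : x != v -> rk' x = rk x by rewrite /rk' => /negPf->.
have rkle x : x \in S' -> rk' x <= #|S2|.
  move=> xS; have [->|nx] := eqVneq x v; first by rewrite rkv.
  by rewrite rkn // ltnW // rkS // inS2.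
exists rk', col'; split.
- by move=> x; rewrite /col'; case: ifP.
- by move=> x /rkle; rewrite cS2.
- move=> x y xS yS; have [->|nx] := eqVneq x v; have [->|ny] := eqVneq y v => //.
  + by rewrite rkv rkn // => E; have := rkS y (inS2 _ yS ny); rewrite -E ltnn.
  + by rewrite rkv rkn // => E; have := rkS x (inS2 _ xS nx); rewrite E ltnn.
  + by rewrite !rkn // => /rkI; apply; apply: inS2.
- move=> x xS; have [->|nx] := eqVneq x v.
    apply: leq_trans dv; apply/subset_leq_card/subsetP=> z.
    by rewrite !inE => /and3P[-> _ ->].
  apply: leq_trans (rkB x (inS2 _ xS nx)); apply/subset_leq_card/subsetP=> z.
  rewrite !inE (rkn x) // => /and3P[zS lt ->].
  have nz : z != v.
    apply: contraTneq lt => ->; rewrite rkv -leqNgt ltnW //; exact/rkS/inS2.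
  by rewrite nz zS -(rkn z nz) lt.
move=> a b aS bS.
have [-> {a aS}|na] := eqVneq a v; have [-> {b bS}|nb] := eqVneq b v.
- by rewrite ltnn.
- move=> _; rewrite /col' eqxx (negPf nb) => Ec.
  have nbad : b \notin nbh e S' v :|: nbh (later_common S') S' v.
    by apply/negP=> /cP; rewrite Ec eqxx.
  move: nbad; rewrite !in_setU negb_or !inE bS /= => /andP[nvb nco].
  split=> // u uS euv eub H.
  case/negP: nco; apply/andP; split; first by rewrite eq_sym.
  apply/exists_inP; exists u; last by rewrite euv.
  rewrite inE uS andbT; apply/negP=> uS'; case: H => [|]; first by rewrite uS'.
  by rewrite rkv ltnNge rkle.
- by rewrite rkv ltnNge rkle.
- rewrite /col' (negPf na) (negPf nb) !rkn // => lt Ec.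
  have [nab H] := rkC a b (inS2 _ aS na) (inS2 _ bS nb) lt Ec.
  split=> // u uS eua eub H2; apply: (H u) => //.
  have [->|nu] := eqVneq u v; first by left; rewrite !inE eqxx.
  by case: H2 => [nu'|]; [left; rewrite !inE negb_and nu' orbT | rewrite rkn; auto].
Qed.

Lemma rank_coloring : exists rk col : T -> nat, [/\ forall v, col v < ncolors,
  forall v, v \in S -> #|[set w in S | (rk w < rk v) && e v w]| <= back_degree,
  {in S &, injective rk} &
  forall v w, v \in S -> w \in S -> v != w -> col v = col w ->
    [disjoint star rk v & star rk w]].
Proof.
have se := class_sym cC CS; have ie := class_irr cC CS.
have [|u|rk [col [colP _ rkI rkB rkC]]] := @rank_coloring_rec S; rewrite ?setDv ?inE //.
exists rk, col; split=> //.
suff H v w : v \in S -> w \in S -> rk w < rk v -> col v = col w ->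
    [disjoint star rk v & star rk w].
  move=> v w vS wS nvw Ec; case: (ltngtP (rk w) (rk v)) => [lt|lt|E].
  - exact: H.
  - by rewrite disjoint_sym; apply: H.
  - by move: nvw; rewrite (rkI _ _ wS vS E) eqxx.
move=> vS wS lt Ec; have [nvw Hu] := rkC v w vS wS lt Ec.
apply/pred0P=> u /=; rewrite !inE; apply/negbTE/negP.
case/andP=> /orP[/eqP->|/and3P[uS evu ltvu]] /orP[/eqP E|/and3P[_ ewu ltwu]].
- by move: lt; rewrite E ltnn.
- by case/negP: nvw; rewrite se.
- by move: ltvu; rewrite E; move: lt; lia.
- by apply: (Hu u) => //; rewrite 1?se //; right.
Qed.
End Ordering.
End Pieces.

(** * Menger's theorem *)

Section Walks.
Variable T : finType.
Implicit Types (e : rel T) (A B Y Z : {set T}) (p : seq T).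

Definition walk e A B p :=
  if p is x :: s then [&& path e x s, x \in A & last x s \in B] else false.

Definition separates e A B Z := forall p, walk e A B p -> has (mem Z) p.

Definition linkage e A B n (P : 'I_n -> seq T) :=
  (forall i, walk e A B (P i)) /\
  (forall i j x, x \in P i -> x \in P j -> i = j).

Lemma split_last_hit (a : pred T) p : has a p ->
  exists p1 z p2, [/\ p = p1 ++ z :: p2, a z & ~~ has a p2].
Proof.
elim: p => // x p IH /=; case: (boolP (has a p)) => hp.
  by have [p1 [z [p2 [-> az np]]]] := IH hp; exists (x :: p1), z, p2.
by rewrite orbF => ax; exists [::], x, p.
Qed.

Lemma split_first_hit (a : pred T) p : has a p ->
  exists p1 z p2, [/\ p = p1 ++ z :: p2, a z & ~~ has a p1].
Proof.
elim: p => // x p IH /=; case: (boolP (a x)) => ax; first by exists [::], x, p.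
move=> hp; have [p1 [z [p2 [-> az np]]]] := IH hp.
by exists (x :: p1), z, p2; rewrite /= (negPf ax).
Qed.

Lemma mem_split (z : T) p : z \in p -> exists p1 p2, p = p1 ++ z :: p2.
Proof. by case/splitPr=> p1 p2; exists p1, p2. Qed.

Lemma walk_prefix e A B Z p1 z p2 :
  walk e A B (p1 ++ z :: p2) -> z \in Z -> walk e A Z (rcons p1 z).
Proof.
case: p1 => [|x p1] /=; first by case/and3P=> _ -> _ ->.
rewrite cat_path rcons_path last_rcons /=.
by move=> /and3P[/and3P[-> -> _] -> _] ->.
Qed.

Lemma walk_suffix e A B Z p1 z p2 :
  walk e A B (p1 ++ z :: p2) -> z \in Z -> walk e Z B (z :: p2).
Proof.
case: p1 => [|x p1] /=; first by case/and3P=> -> _ -> ->.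
by rewrite cat_path last_cat /= => /and3P[/and3P[_ _ ->] _ ->] ->.
Qed.

Lemma walk_cat e A B Z Z' p1 z p2 :
  walk e A Z (rcons p1 z) -> walk e Z' B (z :: p2) -> walk e A B (p1 ++ z :: p2).
Proof.
case: p1 => [|x p1] /=.
  by move=> /andP[-> _] /and3P[-> _ ->].
rewrite cat_path rcons_path last_cat /=.
by move=> /and3P[/andP[-> ->] -> _] /and3P[-> _ ->].
Qed.

(** Only one direction is deleted: relations are treated as directed graphs here. *)
Definition del_arc e x y : rel T := [rel a b | e a b && ~~ ((a == x) && (b == y))].

Lemma path_del_arc_src e x y z s :
  path e z s -> x \notin belast z s -> path (del_arc e x y) z s.
Proof.
elim: s z => //= a s IH z /andP[ez pa]; rewrite inE negb_or => /andP[zx xs].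
by rewrite IH // andbT /del_arc /= ez eq_sym (negPf zx).
Qed.

Lemma path_del_arc_tgt e x y z s :
  path e z s -> y \notin s -> path (del_arc e x y) z s.
Proof.
elim: s z => //= a s IH z /andP[ez pa]; rewrite inE negb_or => /andP[ya ys].
by rewrite IH // andbT /del_arc /= ez [a == y]eq_sym (negPf ya) andbF.
Qed.

Lemma del_arc_sub e x y : subrel (del_arc e x y) e.
Proof. by move=> a b /andP[]. Qed.

Lemma walk_sub e e' A B p : subrel e e' -> walk e A B p -> walk e' A B p.
Proof. by case: p => //= x s se /and3P[/(sub_path se) -> -> ->]. Qed.

Lemma arcs_del_lt e x y : e x y ->
  #|[set a : T * T | del_arc e x y a.1 a.2]| < #|[set a : T * T | e a.1 a.2]|.
Proof.
move=> exy; apply: proper_card; apply/properP; split.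
  by apply/subsetP=> a; rewrite !inE => /andP[].
by exists (x, y); rewrite !inE /= ?/del_arc /= exy ?eqxx.
Qed.

Lemma separates_del_src e A B x y Z :
  separates (del_arc e x y) A B Z -> separates e A B (x |: Z).
Proof.
move=> sepZ p wp; apply/negPn/negP => /hasPn np.
have xp : x \notin p by apply/negP=> /np; rewrite !inE eqxx.
have : walk (del_arc e x y) A B p.
  case: p wp xp {np} => //= z s /and3P[pz -> ->] xs; rewrite !andbT.
  apply: path_del_arc_src => //; apply: contra xs; exact: mem_belast.
by move/sepZ/hasP=> [z zp /= zZ]; have := np z zp; rewrite !inE zZ orbT.
Qed.

Lemma separates_del_tgt e A B x y Z :
  separates (del_arc e x y) A B Z -> separates e A B (y |: Z).
Proof.
move=> sepZ p wp; apply/negPn/negP => /hasPn np.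
have yp : y \notin p by apply/negP=> /np; rewrite !inE eqxx.
have : walk (del_arc e x y) A B p.
  case: p wp yp {np} => //= z s /and3P[pz -> ->]; rewrite inE negb_or !andbT.
  by case/andP=> _ ys; apply: path_del_arc_tgt.
by move/sepZ/hasP=> [z zp /= zZ]; have := np z zp; rewrite !inE zZ orbT.
Qed.

(** The prefix up to the first vertex in [Y] can contain [x] only as its end, hence never uses the
    arc from [x] to [y]. *)
Lemma separates_prefix e A B x y Y Z : x \in Y ->
  separates e A B Y -> separates (del_arc e x y) A Y Z -> separates e A B Z.
Proof.
move=> xY sepY sepZ p wp.
have [p1 [z [p2 [Ep /= zY np]]]] := split_first_hit (sepY _ wp).
rewrite Ep in wp *.
have w1 := walk_prefix wp zY.
have : walk (del_arc e x y) A Y (rcons p1 z).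
  move: w1; rewrite headI /= => /and3P[pz -> ->]; rewrite !andbT.
  apply: path_del_arc_src => //.
  have -> : belast (head z p1) (behead (rcons p1 z)) = p1.
    by case: (p1) => //= a l; rewrite belast_rcons.
  by apply/negP=> xp; move/hasPn/(_ _ xp): np; rewrite /= xY.
by move/sepZ; rewrite -cat_rcons has_cat => ->.
Qed.

(** The suffix from the last vertex in [Y] can contain [y] only as its start, hence never uses the
    arc from [x] to [y]. *)
Lemma separates_suffix e A B x y Y Z : y \in Y ->
  separates e A B Y -> separates (del_arc e x y) Y B Z -> separates e A B Z.
Proof.
move=> yY sepY sepZ p wp.
have [p1 [z [p2 [Ep /= zY np]]]] := split_last_hit (sepY _ wp).
rewrite Ep in wp *.
have : walk (del_arc e x y) Y B (z :: p2).
  have /= /and3P[pz -> ->] := walk_suffix wp zY; rewrite !andbT.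
  apply: path_del_arc_tgt => //.
  by apply/negP=> xp; move/hasPn/(_ _ xp): np; rewrite /= yY.
by move/sepZ; rewrite has_cat => ->; rewrite orbT.
Qed.

(** The [n] disjoint walks have [n] different ends, which exhaust [B]. *)
Lemma linkage_ends e A B n (P : 'I_n -> seq T) z :
  linkage e A B P -> #|B| = n -> z \in B -> exists i p, P i = rcons p z.
Proof.
move=> [wP dP] cB zB; pose t i := last z (P i).
have tP i : t i \in B /\ exists p, P i = rcons p (t i).
  rewrite /t; have := wP i; case: (P i) => //= x s /and3P[_ _ ->]; split=> //.
  by exists (belast x s); rewrite -lastI.
have tin j : t j \in P j by have [_ [p ->]] := tP j; rewrite mem_rcons inE eqxx.
have tinj : injective t by move=> j k E; apply: (dP j k (t j)); rewrite // E.
have : B \subset [set t j | j : 'I_n].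
  have sB : [set t j | j : 'I_n] \subset B.
    by apply/subsetP=> _ /imsetP[j _ ->]; have [] := tP j.
  by rewrite -(subset_leqif_card sB).2 card_imset // card_ord cB.
by move/subsetP/(_ _ zB)/imsetP=> [j _ ->]; exists j; case: (tP j).
Qed.

Lemma linkage_heads e A B n (P : 'I_n -> seq T) z :
  linkage e A B P -> #|A| = n -> z \in A -> exists i p, P i = z :: p.
Proof.
move=> [wP dP] cA zA; pose t i := head z (P i).
have tP i : t i \in A /\ exists p, P i = t i :: p.
  rewrite /t; have := wP i.
  by case: (P i) => //= x s /and3P[_ -> _]; split=> //; exists s.
have tin j : t j \in P j by have [_ [p ->]] := tP j; rewrite inE eqxx.
have tinj : injective t by move=> j k E; apply: (dP j k (t j)); rewrite // E.
have : A \subset [set t j | j : 'I_n].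
  have sA : [set t j | j : 'I_n] \subset A.
    by apply/subsetP=> _ /imsetP[j _ ->]; have [] := tP j.
  by rewrite -(subset_leqif_card sA).2 card_imset // card_ord cA.
by move/subsetP/(_ _ zA)/imsetP=> [j _ ->]; exists j; case: (tP j).
Qed.

Lemma walk_uniq e A B p : walk e A B p ->
  exists q, [/\ walk e A B q, uniq q & {subset q <= p}].
Proof.
case: p => //= x s /and3P[pa xA lB]; case/shortenP: pa lB => q pq uq sq lB.
exists (x :: q); split=> //=; first by rewrite pq xA.
by move=> z; rewrite !inE => /orP[->//|/sq->]; rewrite orbT.
Qed.

Lemma linkage_uniq e A B n (P : 'I_n -> seq T) : linkage e A B P ->
  exists Q : 'I_n -> seq T, linkage e A B Q /\ forall i, uniq (Q i).
Proof.
move=> [wP dP].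
have /fin_all_exists[Q QP] i := walk_uniq (wP i).
exists Q; split=> [|i]; last by case: (QP i).
split=> [i | i j z]; first by case: (QP i).
by have [_ _ si] := QP i; have [_ _ sj] := QP j => /si zi /sj; apply: dP.
Qed.

(* Göring's proof: if a set [S] with [#|S| < n] separates after deleting an arc
   [x -> y], then [x |: S] and [y |: S] separate, and the linkages from [A] to
   [x |: S] and from [y |: S] to [B] can be glued along [S] and the arc. *)
Theorem menger e A B n :
  (exists P : 'I_n -> seq T, linkage e A B P) \/
  (exists2 Z, separates e A B Z & #|Z| < n).
Proof.
have [m lem] := ubnP #|[set a : T * T | e a.1 a.2]|.
elim: m e A B lem => // m IH e A B lem.
have [[x y] /= exy | noe] := pickP [pred a : T * T | e a.1 a.2]; last first.
  have {}noe a b : e a b = false by have := noe (a, b).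
  (* Without arcs every walk is a single vertex, so the elements of [A :&: B] give both the walks
     and the separator. *)
  have sepAB : separates e A B (A :&: B).
    move=> [//|z [|b s]] /=; last by rewrite noe.
    by move=> /andP[zA zB]; rewrite inE zA zB.
  have [cAB | ] := leqP n #|A :&: B|; last by right; exists (A :&: B).
  left; have [n0 | n_gt0] := posnP n.
    by exists (fun=> [::]); split=> [i|i]; have := ltn_ord i; rewrite {2}n0.
  have /card_gt0P[z0 _] : 0 < #|A :&: B| by apply: leq_trans cAB.
  exists (fun i : 'I_n => [:: nth z0 (enum (A :&: B)) i]).
  have szi (i : 'I_n) : i < size (enum (A :&: B)).
    by rewrite -cardE; apply: leq_trans cAB.
  split=> [i | i j z].
    by have := mem_nth z0 (szi i); rewrite mem_enum inE /= => /andP[-> ->].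
  rewrite !inE => /eqP-> E; apply/val_inj/eqP.
  by rewrite -(nth_uniq z0 (szi i) (szi j)) ?enum_uniq.
set e' := del_arc e x y.
have lt_e' : #|[set a : T * T | e' a.1 a.2]| < m.
  by apply: leq_trans (arcs_del_lt exy) _.
have se : subrel e' e by apply: del_arc_sub.
have [[P [wP dP]]|[S sepS ltS]] := IH e' A B lt_e'.
  by left; exists P; split=> // i; apply: walk_sub (wP i).
have sepx := separates_del_src sepS; have sepy := separates_del_tgt sepS.
have [cx | ] := leqP n #|x |: S|; last by right; exists (x |: S).
have [cy | ] := leqP n #|y |: S|; last by right; exists (y |: S).
have xS : x \notin S by move: cx ltS; rewrite cardsU1; case: (x \in S) => //=; lia.
have yS : y \notin S by move: cy ltS; rewrite cardsU1; case: (y \in S) => //=; lia.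
have Ex : #|x |: S| = n by move: cx ltS; rewrite cardsU1 xS; lia.
have Ey : #|y |: S| = n by move: cy ltS; rewrite cardsU1 yS; lia.
have [[P lP]|[Z sepZ ltZ]] := IH e' A (x |: S) lt_e'; last first.
  by right; exists Z => //; apply: separates_prefix sepx sepZ; rewrite !inE eqxx.
have [[Q lQ]|[Z sepZ ltZ]] := IH e' (y |: S) B lt_e'; last first.
  by right; exists Z => //; apply: separates_suffix sepy sepZ; rewrite !inE eqxx.
left.
have {P lP} [P [lP uP]] := linkage_uniq lP; have {Q lQ} [Q [lQ uQ]] := linkage_uniq lQ.
have [wP dP] := lP; have [wQ dQ] := lQ.
have endP i z : z \in P i -> z \in x |: S -> exists p, P i = rcons p z.
  move=> zP zS; have [j [p Ej]] := linkage_ends lP Ex zS.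
  by exists p; rewrite -Ej; congr P; apply: dP zP _; rewrite Ej mem_rcons inE eqxx.
have headQ i z : z \in Q i -> z \in y |: S -> exists p, Q i = z :: p.
  move=> zP zS; have [j [p Ej]] := linkage_heads lQ Ey zS.
  by exists p; rewrite -Ej; congr Q; apply: dQ zP _; rewrite Ej inE eqxx.
(* Switching from [P i] to [Q j] at [z] gives a walk avoiding the deleted arc, so [S] meets it. But
   [P i] meets [S] only at its end and [Q j] only at its head, and both are simple, so this vertex
   is [z]. *)
have key i j z : z \in P i -> z \in Q j ->
    [/\ z \in S, exists p, P i = rcons p z & exists q, Q j = z :: q].
  move=> zP zQ; have wPi := wP i; have wQj := wQ j.
  have [p1 [p2 EP]] := mem_split zP; have [q1 [q2 EQ]] := mem_split zQ.
  have uPi := uP i; have uQj := uQ j; rewrite EP in wPi uPi; rewrite EQ in wQj uQj.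
  have zz : z \in [set z] by rewrite inE.
  have w := walk_cat (walk_prefix wPi zz) (walk_suffix wQj zz).
  have /hasP[s] := sepS _ w; rewrite -cat_rcons mem_cat /= => /orP[sp|sq] sS.
    have sP : s \in P i by rewrite EP -cat_rcons mem_cat sp.
    have sxS : s \in x |: S by rewrite inE sS orbT.
    have [p Ep] := endP i s sP sxS.
    have Es : s = z.
      apply/eqP/negPn/negP=> nsz.
      move: sp; rewrite mem_rcons inE (negPf nsz) /= => sp1.
      have : s \in z :: p2.
        have := congr1 (last z) Ep; rewrite EP last_rcons last_cat /= => <-.
        exact: mem_last.
      by move: uPi; rewrite cat_uniq => /and3P[_ /hasPn ns _] /ns; rewrite /= sp1.
    rewrite -Es; split=> //; first by exists p.
    by apply: headQ; rewrite ?Es // -Es inE sS orbT.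
  have sQ : s \in Q j by rewrite EQ mem_cat inE sq !orbT.
  have syS : s \in y |: S by rewrite inE sS orbT.
  have [q Eq] := headQ j s sQ syS.
  move: uQj; rewrite -cat_rcons cat_uniq => /and3P[_ /hasPn ns _].
  have /negP[] := ns s sq.
  have := congr1 (head z) Eq; rewrite EQ /= => <-.
  by case: (q1) => //= *; rewrite inE eqxx.
(* [g] sends the end of a first half to the head of the matching second half: [x] crosses the arc to
   [y], and a vertex of [S] is matched with itself. *)
pose g z := if z == x then y else z.
pose t i := last x (P i).
have tP i : t i \in P i /\ t i \in x |: S.
  by rewrite /t; have := wP i; case: (P i) => //= a s /and3P[_ _ ->]; rewrite mem_last.
have /fin_all_exists[f fP] i : exists j p, Q j = g (t i) :: p.
  apply: (linkage_heads lQ Ey); rewrite /g; case: eqP => [_|/eqP nx].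
    by rewrite !inE eqxx.
  by have [_] := tP i; rewrite !inE (negPf nx) => /= ->; rewrite orbT.
(* When the halves meet in a vertex of [S], [behead] removes its second copy. *)
exists (fun i => P i ++ (if t i == x then Q (f i) else behead (Q (f i)))).
split=> [i | i j z].
  have [p Ep] := fP i; move: (wP i) (wQ (f i)); rewrite Ep /= /t /g.
  case: (P i) => //= a s /and3P[/(sub_path se) pa aA _].
  case: eqP => [E | _] /and3P[/(sub_path se) pq _ lB].
    by rewrite cat_path last_cat pa aA /= E exy pq.
  by rewrite cat_path last_cat pa aA pq.
have sub k : z \in P k ++ (if t k == x then Q (f k) else behead (Q (f k))) ->
    z \in P k \/ z \in Q (f k).
  rewrite mem_cat => /orP[zP|zQ]; [by left | right].
  by move: zQ; case: ifP => // _; apply: mem_behead.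
have mix i1 j1 : z \in P i1 -> z \in Q (f j1) -> i1 = j1.
  move=> zP zQ; have [zS [p EP] [q EQ]] := key _ _ _ zP zQ.
  have [q' EQ'] := fP j1; move: EQ'; rewrite EQ => -[Eg _].
  have Et : t j1 = z.
    by move: Eg yS; rewrite /g; case: eqP => // _ <-; rewrite zS.
  by apply: dP zP _; rewrite -Et; case: (tP j1).
have fI : injective f.
  move=> i1 j1 Ef; have [p] := fP i1; have [q] := fP j1; rewrite Ef => -> [Eg _].
  have [ti Ti] := tP i1; have [tj Tj] := tP j1.
  suff Et : t i1 = t j1 by apply: (dP _ _ (t i1)) => //; rewrite Et.
  have gS k : t k != x -> g (t k) != y.
    move=> nk; rewrite /g (negPf nk); apply/eqP=> Ek; case: (tP k) => _.
    by rewrite !inE (negPf nk) Ek (negPf yS).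
  have gx : g x = y by rewrite /g eqxx.
  have [Ei|ni] := eqVneq (t i1) x; have [Ej|nj] := eqVneq (t j1) x.
  - by rewrite Ei Ej.
  - by have := gS _ nj; rewrite Eg Ei gx eqxx.
  - by have := gS _ ni; rewrite -Eg Ej gx eqxx.
  - by move: Eg; rewrite /g (negPf ni) (negPf nj).
move=> /sub[] zi /sub[] zj; [exact: dP zi zj|exact: mix|exact/esym/mix|].
exact: fI (dQ _ _ _ zi zj).
Qed.
End Walks.

(** * Vertices touching many paths *)

Section Cutting.
Variable T : finType.
Implicit Types (e f : rel T) (S U W X Y R P : {set T}) (x y z : T).
Implicit Types (YY PP : {set {set T}}).

Lemma nbhs0 e X : nbhs e X set0 = set0.
Proof.
apply/setP=> x; rewrite [RHS]inE; apply/negP=> /nbhsP[_ [y]].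
by rewrite inE.
Qed.

Lemma nbhsU1 e X Y x : symmetric e -> nbhs e X (x |: Y) = nbh e X x :|: nbhs e X Y.
Proof.
move=> se; apply/setP=> z; rewrite in_setU [z \in nbh _ _ _]inE.
apply/nbhsP/orP => [[zX [y]]|[/andP[zX exz]|/nbhsP[zX [y yY ezy]]]].
- rewrite in_setU1 => /orP[/eqP->|yY] ezy; first by left; rewrite zX se.
  by right; apply/nbhsP; split=> //; exists y.
- by split=> //; exists x; rewrite ?setU11 // se.
by split=> //; exists y => //; rewrite in_setU1 yY orbT.
Qed.

(* The path is scanned from its end; [cur] is the piece under construction, which
   is closed as soon as it sees [t] vertices of [X] and abandoned at a vertex of
   [X].  A closed piece sees at most [t] vertices of [X] plus the neighbours of
   the vertex of [Z] that closed it. *)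
Lemma cut_path e X t s : symmetric e -> 0 < t -> uniq s -> sorted e s ->
  exists (cur : {set T}) YY (Z W : {set T}),
  [/\ cur \subset [set z in s] :\: X, conn e cur, #|nbhs e X cur| < t &
      cur = set0 \/ exists h s', s = h :: s' /\ h \in cur] /\
  [/\ trivIset YY, forall Y, Y \in YY ->
        [/\ Y \subset [set z in s] :\: X :\: cur, conn e Y & t <= #|nbhs e X Y|],
      Z \subset [set z in s] :\: X /\ #|Z| <= #|YY|,
      nbhs e X ([set z in s] :\: X) \subset nbhs e X cur :|: W &
      #|W| <= t * (#|[set z in s] :&: X| + #|YY|) + \sum_(z in Z) #|nbh e X z|].
Proof.
move=> se t0; elim: s => [|x s IH].
  move=> _ _; exists set0, set0, set0, set0; rewrite ?nbhs0 ?cards0 ?big_set0.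
  split; split=> //; rewrite ?sub0set //; first by move=> a b; rewrite inE.
  - by left.
  - by apply/trivIsetP=> A B; rewrite inE.
  - by move=> Y; rewrite inE.
  rewrite (_ : _ :\: X = set0) ?nbhs0 ?sub0set //.
  by apply/setP=> z; rewrite !inE andbF.
case/andP=> xs us px.
have [cur [YY [Z [W [[curS curC curN curH] [tY YP [sZ cZ] NW cW]]]]]] :=
  IH us (path_sorted px).
have sxs : [set z in s] \subset [set z in x :: s].
  by apply/subsetP=> z; rewrite !inE orbC => ->.
have [xX | xX] := boolP (x \in X).
  have Es : [set z in x :: s] :\: X = [set z in s] :\: X.
    by apply/setP=> z; rewrite !inE; case: eqP => // ->; rewrite xX.
  exists set0, YY, Z, (W :|: nbhs e X cur); rewrite nbhs0 cards0 set0U Es; split; split=> //.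
  - by rewrite sub0set.
  - by move=> a b; rewrite inE.
  - by left.
  - move=> Y /YP[sY cY nY]; split=> //; rewrite setD0.
    exact: subset_trans sY (subsetDl _ _).
  - by rewrite setUC.
  have -> : #|[set z in x :: s] :&: X| = #|[set z in s] :&: X|.+1.
    rewrite (cardsD1 x) !inE eqxx xX /= add1n; congr _.+1; apply: eq_card => z.
    by rewrite !inE; case: eqP => // ->; rewrite (negPf xs).
  have le_U : #|W :|: nbhs e X cur| <= #|W| + #|nbhs e X cur| := leq_card_setU _ _.
  move: cW curN le_U; set a := #|_ :&: X|; set b := \sum_(z in Z) _; clear; nia.
set cur1 := x |: cur.
(* A nonempty [cur] contains the head of the scanned suffix, which is adjacent to [x]. *)
have cur1C : conn e cur1.
  case: curH => [cur0 | [h [s' [Es hcur]]]]; first by rewrite /cur1 cur0 setU0; apply: conn1.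
  by apply: conn_add hcur _ => //; move: px; rewrite Es /= => /andP[].
have cur1S : cur1 \subset [set z in x :: s] :\: X.
  rewrite subUset sub1set !inE eqxx xX /=; apply: subset_trans curS _; exact: setSD.
have Es : [set z in x :: s] :\: X = x |: ([set z in s] :\: X).
  by apply/setP=> z; rewrite !inE; case: eqP => // ->; rewrite xX.
have EI : [set z in x :: s] :&: X = [set z in s] :&: X.
  by apply/setP=> z; rewrite !inE; case: eqP => // ->; rewrite (negPf xX) !andbF.
have YxP Y : Y \in YY -> [/\ Y \subset [set z in x :: s] :\: X :\: cur1, x \notin Y,
    conn e Y & t <= #|nbhs e X Y|].
  case/YP=> sY cY nY; have xY : x \notin Y.
    by apply/negP=> /(subsetP sY); rewrite !inE (negPf xs) !andbF.
  split=> //; apply/subsetP=> z zY; have := subsetP sY _ zY; rewrite !inE.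
  case/and3P=> zc zX zs; rewrite zX zs orbT !andbT negb_or zc andbT.
  by apply: contraNneq xY => <-.
have sZ' : Z \subset [set z in x :: s] :\: X by apply: subset_trans sZ (setSD _ sxs).
have [small | big] := ltnP #|nbhs e X cur1| t.
  exists cur1, YY, Z, W; split; split=> //.
  - by right; exists x, s; rewrite setU11.
  - by move=> Y /YxP[].
  - rewrite Es /cur1 !nbhsU1 // -setUA; exact: setUS.
  - by rewrite EI.
have xcur1 : x \in cur1 by rewrite setU11.
have n1 : cur1 \notin YY by apply/negP=> /YxP[_]; rewrite xcur1.
have xZ : x \notin Z by apply/negP=> /(subsetP sZ); rewrite !inE (negPf xs) andbF.
exists set0, (cur1 |: YY), (x |: Z), (W :|: (nbhs e X cur :|: nbh e X x)).
rewrite nbhs0 cards0 set0U; split; split=> //.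
- by rewrite sub0set.
- by move=> a b; rewrite inE.
- by left.
- apply/trivIsetP=> A B; rewrite !in_setU1.
  have dis Y : Y \in YY -> [disjoint cur1 & Y].
    case/YxP=> sY _ _ _; rewrite disjoint_sym; apply/pred0P=> z /=; apply/negP.
    by case/andP=> /(subsetP sY); rewrite inE => /andP[/negPf->].
  case/orP=> [/eqP->|AY] /orP[/eqP->|BY]; rewrite ?eqxx // => nAB.
  + exact: dis.
  + by rewrite disjoint_sym; apply: dis.
  + exact: (trivIsetP tY).
- move=> Y; rewrite in_setU1 setD0 => /orP[/eqP-> //|/YxP[sY _ cY nY]].
  by split=> //; apply: subset_trans sY (subsetDl _ _).
- rewrite subUset sub1set sZ' !cardsU1 n1 xZ !inE eqxx xX; split=> //.
- rewrite Es nbhsU1 // setUA setUC; apply: setSU.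
  by rewrite setUC.
rewrite EI !cardsU1 n1 (big_setU1 _ xZ) /=.
set V := _ :|: nbh e X x.
have le_U : #|W :|: V| <= #|W| + #|V| := leq_card_setU _ _.
have le_V : #|V| <= #|nbhs e X cur| + #|nbh e X x| := leq_card_setU _ _.
move: cW curN le_U le_V; set a := #|_ :&: X|; set b := \sum_(z in Z) _; clearbody V a b; clear. rewrite !mulnDr.
move: #|W :|: V| #|W| #|V| #|nbhs e X cur| #|nbh e X x| #|YY| => i j k l m n. lia.
Qed.

Definition path_set e P := exists s, [/\ uniq s, sorted e s & P = [set z in s]].

Definition touched e PP x := [set P in PP | [exists y in P, (y == x) || e x y]].

(** The summands are what [few_touching_many] has to beat per vertex of [X]: 1 for its own path,
    [mader r] for the arcs inside [X], and the coefficient of [#|X|] in [sum_nbhs]. The surplus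
    [2 * r] is weighed against [r * #|PP|]. *)
Definition touch_bound r :=
  1 + mader r + r + r * mader r + mader r + mader r * mader r + 2 * r.

Section Big.
Variables (C : {set T} -> rel T -> Prop) (r : nat) (S : {set T}) (e : rel T).
Hypotheses (cC : closed_class C) (r0 : 0 < r) (fC : clique_free r C) (CS : C S e).
Variable PP : {set {set T}}.
Hypotheses (tPP : trivIset PP) (sPP : cover PP \subset S).
Hypothesis pPP : forall P, P \in PP -> path_set e P.

Lemma member_sub P : P \in PP -> P \subset cover PP.
Proof. by move=> PPP; apply/subsetP=> z zP; apply/bigcupP; exists P. Qed.

Lemma sum_cover (g : T -> nat) : \sum_(P in PP) \sum_(z in P) g z <= \sum_z g z.
Proof.
rewrite -(big_trivIset _ tPP) /= [leqRHS](bigID (mem (cover PP))) /=.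
exact: leq_addr.
Qed.

(** Each path is cut by [cut_path] with threshold [r]. A closed piece sees at least [r] vertices of
    [X], too many for a clique, so [piece_assignment] spends every piece and there are at most
    [mader r * #|X|] of them. The closing vertices are no more numerous, so Mader's bound on their
    union with [X] controls their edges to [X]. *)
Lemma sum_nbhs X : X \subset S ->
  \sum_(P in PP) #|nbhs e X (P :\: X)| <=
  r * #|PP| + (r + r * mader r + mader r + mader r * mader r) * #|X|.
Proof.
move=> sX; set c := mader r; have se := class_sym cC CS.
have bnd S1 f : C S1 f -> arcs f S1 <= c * #|S1| by apply: mader_bound.
have /fin_all_exists[F FP] (P : {set T}) : exists F : {set {set T}} * {set T},
    P \in PP -> [/\ trivIset F.1, forall Y, Y \in F.1 ->
        [/\ Y \subset P :\: X, conn e Y & r <= #|nbhs e X Y|],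
      F.2 \subset P :\: X, #|F.2| <= #|F.1| &
      #|nbhs e X (P :\: X)| <=
        r + r * (#|P :&: X| + #|F.1|) + \sum_(z in F.2) #|nbh e X z|].
  have [PPP | ] := boolP (P \in PP); last by exists (set0, set0).
  have [s [us ps EP]] := pPP PPP.
  have [cur [YY [Z [W [[curS curC curN _] [tY YP [sZ cZ] NW cW]]]]]] :=
    cut_path X se r0 us ps.
  exists (YY, Z) => _ /=; rewrite EP; split=> //.
    by move=> Y /YP[sY cY nY]; split=> //; apply: subset_trans sY (subsetDl _ _).
  apply: leq_trans (subset_leq_card NW) _.
  apply: leq_trans (leq_card_setU _ _) _; rewrite -addnA.
  by apply: leq_add cW; apply: ltnW.
(* Pieces are tagged with their path, so that their number is the sum over the paths. *)
pose Q := [set q : {set T} * {set T} | (q.1 \in PP) && (q.2 \in (F q.1).1)].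
pose YY := [set q.2 | q in Q].
have QP q : q \in Q -> [/\ q.1 \in PP, q.2 \subset q.1 :\: X, conn e q.2 &
    r <= #|nbhs e X q.2|].
  rewrite inE => /andP[q1 q2]; have [_ YP _ _ _] := FP _ q1.
  by have [sY cY nY] := YP _ q2; split.
have qne q : q \in Q -> exists z, z \in q.2.
  case/QP=> _ _ _; case: (set_0Vmem q.2) => [->|[z zq] _]; last by exists z.
  by rewrite nbhs0 cards0 leqNgt r0.
have q1E q q' z : q \in Q -> q' \in Q -> z \in q.2 -> z \in q'.2 -> q.1 = q'.1.
  move=> /QP[q1 qs _ _] /QP[q1' qs' _ _] /(subsetP qs) zq /(subsetP qs') zq'.
  move: zq zq'; rewrite !in_setD => /andP[_ zq] /andP[_ zq'].
  by rewrite -(def_pblock tPP q1 zq) -(def_pblock tPP q1' zq').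
have tYY : trivIset YY.
  apply/trivIsetP=> _ _ /imsetP[q qQ ->] /imsetP[q' qQ' ->] nqq.
  apply/pred0P=> z /=; apply/negP=> /andP[zq zq'].
  have E1 := q1E _ _ _ qQ qQ' zq zq'.
  move: (qQ) (qQ'); rewrite !inE -E1 => /andP[q1 q2] /andP[_ q2'].
  have [tF _ _ _ _] := FP _ q1; have := trivIsetP tF _ _ q2 q2' nqq.
  by move/pred0P/(_ z); rewrite /= zq zq'.
have cYY : #|YY| = \sum_(P in PP) #|(F P).1|.
  rewrite card_in_imset; last first.
    move=> q q' qQ qQ' E2; have [z zq] := qne _ qQ; have zq' := zq; rewrite E2 in zq'.
    by rewrite [q]surjective_pairing [q']surjective_pairing E2 (q1E _ _ _ qQ qQ' zq zq').
  rewrite -sum1_card; under [RHS]eq_bigr do rewrite -sum1_card.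
  by rewrite pair_big_dep /=; apply: eq_bigl => q; rewrite inE.
have [|f [YY' [Cf sY' aY' clY']]] := piece_assignment cC CS sX tYY.
  move=> _ /imsetP[q /QP[q1 qs cq _] ->]; split=> //.
  apply: subset_trans qs _; apply: setSD; apply: subset_trans sPP.
  exact: member_sub.
have YYc : #|YY| <= c * #|X|.
  apply: leq_trans (bnd _ _ Cf); apply: leq_trans aY'.
  apply: leq_trans (_ : #|YY'| <= _); last by rewrite leq_pmull.
  apply/subset_leq_card/subsetP=> Y YYY; apply: contraT => nY.
  have [q /QP[_ _ _ nq] EY] := imsetP YYY.
  have := fC Cf _ (clY' _ YYY nY); rewrite EY ltnNge nq; apply.
  by apply/subsetP=> z /nbhsP[].
pose Z := \bigcup_(P in PP) (F P).2.
have ZX : Z \subset S :\: X.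
  apply/bigcupsP=> P PPP; have [_ _ sZ _ _] := FP _ PPP.
  by apply: subset_trans sZ (setSD _ (subset_trans _ sPP)); apply: member_sub.
have cZ : #|Z| <= c * #|X|.
  apply: leq_trans YYc; rewrite cYY; apply: leq_trans (card_bigcup_le _ _) _.
  by apply: leq_sum => P PPP; have [] := FP _ PPP.
have sumZ : \sum_(P in PP) \sum_(z in (F P).2) #|nbh e X z| <= c * (#|X| + c * #|X|).
  apply: leq_trans (_ : \sum_(z in Z) #|nbh e X z| <= _).
    rewrite [leqRHS]big_mkcond; apply: leq_trans (sum_cover _).
    apply: leq_sum => P PPP; have [_ _ sZ _ _] := FP _ PPP.
    rewrite [leqRHS](big_setID (F P).2) /= (setIidPr _); last first.
      exact: subset_trans sZ (subsetDl _ _).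
    apply: leq_trans (leq_addr _ _); apply: leq_sum => z zF.
    by rewrite ifT //; apply/bigcupP; exists P.
  have sXZ : X :|: Z \subset S.
    by rewrite subUset sX (subset_trans ZX) // subsetDl.
  apply: leq_trans (_ : c * #|X :|: Z| <= _); last first.
    by rewrite leq_mul // (leq_trans (leq_card_setU _ _)) // leq_add2l.
  apply: leq_trans (bnd _ _ (class_restrict cC CS sXZ)).
  apply: leq_trans (sum_nbh_sub e (subsetUr X Z)); apply: leq_sum => z _.
  by apply/subset_leq_card/subsetP=> y; rewrite !inE => /andP[-> ->].
have sumX : \sum_(P in PP) #|P :&: X| <= #|X|.
  rewrite -[#|X|]sum1_card [leqRHS]big_mkcond; apply: leq_trans (sum_cover _).
  apply: leq_sum => P _; rewrite -big_mkcondr -sum1_card /=.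
  by rewrite (eq_bigl (fun z => (z \in P) && (z \in X))) // => z; rewrite inE.
apply: leq_trans (_ : \sum_(P in PP) (r + r * (#|P :&: X| + #|(F P).1|) +
  \sum_(z in (F P).2) #|nbh e X z|) <= _).
  by apply: leq_sum => P PPP; have [] := FP _ PPP.
rewrite !big_split /= -big_distrr big_split /= -cYY sum_nat_const.
move: sumX sumZ YYc; clear; move: (\sum_(P in PP) #|P :&: X|) => i.
move: (\sum_(P in PP) \sum_(z in _) _) #|X| #|YY| #|PP| => j k l m.
nia.
Qed.

(** A path touched by [x] is the path of [x], or contains a neighbour of [x] in [X], or has a
    neighbour of [x] outside [X]. Double counting bounds the three kinds by [#|X|], [arcs e X] and
    [sum_nbhs]. *)
Lemma few_touching_many : 2 * #|[set x in cover PP | touch_bound r <= #|touched e PP x|]| <= #|PP|.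
Proof.
set X := [set x in _ | _]; set c := mader r; have se := class_sym cC CS.
have sX : X \subset S.
  by apply: subset_trans sPP; apply/subsetP=> x; rewrite inE => /andP[].
have bnd : arcs e X <= c * #|X|.
  by apply: (mader_bound r0 cC fC); apply: class_restrict CS sX.
have tx x : x \in X ->
    touch_bound r <= 1 + #|[set P in PP | x \in nbhs e X (P :\: X)]| + #|nbh e X x|.
  move=> xX; move: (xX); rewrite inE => /andP[xPP bx]; apply: leq_trans bx _.
  have xP0 := xPP; rewrite -mem_pblock in xP0.
  have -> : 1 = #|[set pblock PP x]| by rewrite cards1.
  apply: leq_trans (_ : #|[set pblock PP x] :|: [set P in PP | x \in nbhs e X (P :\: X)]
     :|: [set pblock PP y | y in nbh e X x]| <= _).
    apply/subset_leq_card/subsetP=> P; rewrite inE => /andP[PPP /exists_inP[y yP]].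
    rewrite !in_setU -orbA; case/orP=> [/eqP Exy | exy].
      by rewrite inE -Exy (def_pblock tPP PPP yP) eqxx.
    have [yX | yX] := boolP (y \in X); apply/or3P.
      apply: Or33; apply/imsetP; exists y; last by rewrite (def_pblock tPP PPP yP).
      by rewrite inE yX.
    apply: Or32; rewrite inE PPP; apply/nbhsP; split; last by exists y; rewrite // in_setD yX yP.
    by [].
  apply: leq_trans (leq_card_setU _ _) _; apply: leq_add; last exact: leq_imset_card.
  exact: leq_card_setU.
have : touch_bound r * #|X| <= #|X| + \sum_(P in PP) #|nbhs e X (P :\: X)| + arcs e X.
  rewrite mulnC -sum_nat_const; 
  apply: leq_trans (_ : \sum_(x in X)
    (1 + #|[set P in PP | x \in nbhs e X (P :\: X)]| + #|nbh e X x|) <= _).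
    exact: leq_sum.
  rewrite !big_split /= sum1_card -arcsE !leq_add2r leq_add2l.
  rewrite (eq_bigr (fun x => \sum_(P in PP) (x \in nbhs e X (P :\: X)))); last first.
    move=> x xX; rewrite -sum1_card big_mkcond [RHS]big_mkcond; apply: eq_bigr => P _.
    by rewrite inE; case: (P \in PP); case: (x \in nbhs _ _ _).
  rewrite exchange_big /=; apply: leq_sum => P _.
  rewrite -[leqRHS]sum1_card big_mkcond [leqRHS]big_mkcond; apply: leq_sum => x _.
  by case: (x \in X); case: (x \in nbhs _ _ _).
have := sum_nbhs sX; move: bnd r0; rewrite /touch_bound -/c; clear.
move: (\sum_(P in PP) _) (arcs e X) #|X| #|PP| => i j k l.
nia.
Qed.
End Big.
End Cutting.

(** * Rerouting through contracted stars *)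

Section Rounds.
Variables (T : finType) (e : rel T).
Hypotheses (se : symmetric e) (ie : irreflexive e).
Implicit Types (A B S U W X Y Q P : {set T}) (x y z v : T) (p q : seq T).
Implicit Types (PP QQ : {set {set T}}).

Definition shortest A B q :=
  forall p, walk e A B p -> {subset p <= q} -> size q <= size p.

Lemma walk_rev A B q : walk e A B q -> walk e B A (rev q).
Proof.
case: q => //= x s /and3P[ps xA lB].
have := rev_path e x s; rewrite (eq_path (e' := e)) => [E|a b]; last by rewrite se.
move: E; rewrite lastI rev_rcons /= lB => ->; rewrite ps /=.
by case: s {ps lB} => //= y s; rewrite rev_cons last_rcons.
Qed.

Lemma shortest_rev A B q : shortest A B q -> shortest B A (rev q).
Proof.
move=> sq p wp sp; rewrite size_rev -[size p]size_rev; apply: sq.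
  exact: walk_rev.
by move=> z; rewrite mem_rev => /sp; rewrite mem_rev.
Qed.

(** If [v] is not the end, membership in [B] would allow stopping early, and a later neighbour other
    than the successor would give a shortcut. *)
Lemma right_load A B q1 v q2 : walk e A B (q1 ++ v :: q2) ->
  uniq (q1 ++ v :: q2) -> shortest A B (q1 ++ v :: q2) ->
  #|nbh e [set z in q2] v| + (v \in B) = 1.
Proof.
move=> wq uq sq.
have vv : v \in [set v] by rewrite inE.
case: q2 wq uq sq => [|w q2] wq uq sq.
  have -> : nbh e [set z in [::]] v = set0 by apply/setP=> z; rewrite !inE.
  rewrite cards0; suff -> : v \in B by [].
  by have /= /andP[] := walk_suffix wq vv.
have evw : e v w by have /= /and3P[/andP[]] := walk_suffix wq vv.
have vB : v \notin B.
  apply/negP=> vB; have := sq _ (walk_prefix wq vB) _.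
  rewrite size_rcons size_cat /= => H; suff: false by [].
  have : size q1 + (size q2).+2 <= (size q1).+1; last by lia.
  by apply: H => z; rewrite mem_rcons inE mem_cat !inE => /orP[]->; rewrite ?orbT.
rewrite (negPf vB) addn0; suff -> : nbh e [set z in w :: q2] v = [set w].
  by rewrite cards1.
apply/setP=> z; rewrite !inE; apply/idP/eqP => [/andP[/orP[/eqP//|zq] evz] | ->]; last first.
  by rewrite eqxx.
have [q3 [q4 Eq]] := mem_split zq.
have zz : z \in [set z] by rewrite inE.
have Eq2 : q1 ++ v :: w :: q2 = (q1 ++ v :: w :: q3) ++ z :: q4 by rewrite Eq -catA.
have w1 : walk e [set v] B (v :: z :: q4).
  have /= /and3P[pz _ lz] := walk_suffix (etrans (esym (congr1 (walk e A B) Eq2)) wq) zz.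
  by rewrite /= !inE eqxx evz pz lz.
have := sq _ (walk_cat (walk_prefix wq vv) w1) _.
rewrite Eq2 !size_cat /= => H; suff: false by [].
have : size q1 + (size q3).+2 + (size q4).+1 <= size q1 + (size q4).+2; last by lia.
apply: H => a; rewrite !mem_cat !inE.
by case/orP=> [->//|/or3P[]->]; rewrite ?orbT.
Qed.

(** Membership in [A] or in [B] makes up for the neighbour that an end of the path lacks. *)
Definition tight A B Q :=
  (exists s, [/\ uniq s, walk e A B s & Q = [set z in s]]) /\
  {in Q, forall v, #|nbh e Q v| + (v \in A) + (v \in B) = 2}.

(** A shortest walk inside [p] works: [right_load] gives each vertex load 1 towards [B] and, after
    reversal, load 1 towards [A]. *)
Lemma tight_exists A B p : walk e A B p ->
  exists2 Q : {set T}, Q \subset [set z in p] & tight A B Q.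
Proof.
(* Tuples of a fixed length make the property decidable, as [ex_minnP] requires. *)
move=> wp; pose good n := [exists q : n.-tuple T, walk e A B q && all (mem p) q].
have ex : exists n, good n.
  exists (size p); apply/existsP; exists (in_tuple p); rewrite /= wp.
  by apply/allP.
case: (ex_minnP ex) => n /existsP[q0 /andP[w0 /allP s0]] minn.
have [q [wq uq sq0]] := walk_uniq w0.
have sqp : {subset q <= p} by move=> z /sq0/s0.
have sizen p' : walk e A B p' -> {subset p' <= p} -> n <= size p'.
  move=> wp' sp'; apply: minn; apply/existsP; exists (in_tuple p'); rewrite /= wp'.
  by apply/allP.
have sq : shortest A B q.
  move=> p' wp' sp'; apply: leq_trans (sizen p' wp' _); last by move=> z /sp'/sqp.
  by rewrite -(size_tuple q0); apply: uniq_leq_size.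
exists [set z in q]; first by apply/subsetP=> z; rewrite !inE => /sqp.
split; first by exists q.
move=> v; rewrite inE => /mem_split[q1 [q2 Eq]]; rewrite Eq in wq uq sq *.
have rR := right_load wq uq sq.
have Er : rev (q1 ++ v :: q2) = rev q2 ++ v :: rev q1.
  by rewrite rev_cat rev_cons cat_rcons.
have := @right_load B A (rev q2) v (rev q1); rewrite -Er rev_uniq => rL.
have {}rL := rL (walk_rev wq) uq (shortest_rev sq).
rewrite (_ : [set z in rev q1] = [set z in q1]) in rL; last first.
  by apply/setP=> z; rewrite !inE mem_rev.
have -> : nbh e [set z in q1 ++ v :: q2] v =
    nbh e [set z in q1] v :|: nbh e [set z in q2] v.
  apply/setP=> z; rewrite !inE mem_cat inE.
  by have [->|_] := eqVneq z v; rewrite ?ie ?andbF // andb_orl.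
rewrite cardsU (_ : _ :&: _ = set0) ?cards0 ?subn0; first by move: rL rR; lia.
apply/setP=> z; rewrite !inE; apply/negP=> /andP[/andP[z1 _] /andP[z2 _]].
by move: uq; rewrite cat_uniq => /and3P[_ /hasPn/(_ z)]; rewrite /= inE z2 orbT z1 => /(_ isT).
Qed.

Lemma connect_walk A B V x y : connect (restr e V) x y -> x \in V ->
  x \in A -> y \in B -> exists2 p, walk e A B p & {subset p <= V}.
Proof.
case/connectP=> s ps -> xV xA yB; exists (x :: s) => /=.
  by rewrite xA yB !andbT; apply: sub_path ps => a b /and3P[].
move=> z; rewrite inE => /orP[/eqP->//|].
by elim: s x ps {xV xA yB} => //= b s IH a /andP[/and3P[_ bV _] /IH H];
  rewrite inE => /orP[/eqP->//|/H].
Qed.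

Definition tight_family A B PP := trivIset PP /\ forall P, P \in PP -> tight A B P.

Lemma tight_family_of A B n (V : 'I_n -> {set T}) :
  (forall i, exists2 p, walk e A B p & {subset p <= V i}) ->
  (forall i j z, z \in V i -> z \in V j -> i = j) ->
  exists Q : 'I_n -> {set T}, [/\ injective Q,
    tight_family A B [set Q i | i : 'I_n] & forall i, Q i \subset V i].
Proof.
move=> wV dV.
have /fin_all_exists[Q QP] i : exists Q : {set T}, Q \subset V i /\ tight A B Q.
  have [p wp sp] := wV i; have [Q sQ tQ] := tight_exists wp; exists Q; split=> //.
  by apply: subset_trans sQ _; apply/subsetP=> z; rewrite inE => /sp.
have sQ i z : z \in Q i -> z \in V i by case: (QP i) => /subsetP s _ /s.
exists Q; split=> [i j E||i]; last by case: (QP i).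
  have [z zi] : exists z, z \in Q i.
    case: (QP i) => _ [[s [_ ws ->]] _]; case: s ws => // x s _.
    by exists x; rewrite !inE eqxx.
  by apply: (dV _ _ z); apply: sQ; rewrite -?E.
split=> [|_ /imsetP[i _ ->]]; last by case: (QP i).
apply/trivIsetP=> _ _ /imsetP[i _ ->] /imsetP[j _ ->] nij.
apply/pred0P=> z /=; apply/negP=> /andP[/sQ zi /sQ zj].
by case/eqP: nij; rewrite (dV _ _ _ zi zj).
Qed.

Section Quotient.
Variables (U : {set T}) (pi : T -> T).
Hypothesis fiber_conn : {in U &, forall x y, pi x = pi y ->
  connect (restr e [set z in U | pi z == pi x]) x y}.

Definition quot : rel T :=
  [rel a b | [exists x in U, exists y in U, [&& pi x == a, pi y == b & e x y]]].

Lemma lift_path a w x y : path quot a w -> x \in U -> y \in U ->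
  pi x = a -> pi y = last a w -> connect (restr e [set z in U | pi z \in a :: w]) x y.
Proof.
elim: w a x => [|b w IH] a x /=.
  move=> _ xU yU Ea Ey; apply: connect_restr_mono (fiber_conn xU yU _); last by rewrite Ea Ey.
  by apply/subsetP=> z; rewrite !inE Ea.
case/andP=> /exists_inP[x1 x1U /exists_inP[y1 y1U /and3P[/eqP Ex1 /eqP Ey1 exy]]] pw.
move=> xU yU Ea Ey.
have c1 : connect (restr e [set z in U | pi z \in a :: b :: w]) x x1.
  apply: connect_restr_mono (fiber_conn xU x1U _); last by rewrite Ea Ex1.
  by apply/subsetP=> z; rewrite !inE Ea => /andP[-> ->].
have c2 : connect (restr e [set z in U | pi z \in a :: b :: w]) x1 y1.
  by apply: connect1; rewrite /restr /= !inE x1U y1U Ex1 Ey1 !eqxx exy orbT.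
apply: connect_trans c1 _; apply: connect_trans c2 _.
apply: connect_restr_mono (IH b y1 pw y1U yU Ey1 Ey).
by apply/subsetP=> z; rewrite !inE => /andP[-> ->]; rewrite orbT.
Qed.

(** A separator of the quotient meets the image of every path of [PP], and each of its vertices
    accounts for at most [D] of them, so it has at least [n] vertices. Disjoint quotient walks lift
    through the connected fibres, and no fibre is used twice. *)
Lemma quotient_round A B PP D n : 0 < D -> tight_family A B PP -> cover PP = U ->
  (forall a, #|[set P in PP | [exists x in P, pi x == a]]| <= D) ->
  D * n <= #|PP| ->
  exists QQ, [/\ tight_family A B QQ, #|QQ| = n, cover QQ \subset U &
    forall Q Q' x y, Q \in QQ -> Q' \in QQ -> x \in Q -> y \in Q' ->
      pi x = pi y -> Q = Q'].
Proof.
move=> D0 [tPP tight_PP] EU touch leD.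
have [[w [wP wD]] | [Z sepZ ltZ]] :=
  menger quot [set pi x | x in A :&: U] [set pi x | x in B :&: U] n; last first.
  suff : #|PP| <= #|Z| * D by move: ltZ leD; nia.
  rewrite -sum_nat_const.
  apply: leq_trans (_ : \sum_(a in Z) #|[set P in PP | [exists x in P, pi x == a]]| <= _);
    last exact: leq_sum.
  apply: leq_trans (card_bigcup_le _ _); apply/subset_leq_card/subsetP=> P PPP.
  have [[s [us ws EP]] _] := tight_PP _ PPP.
  have sU z : z \in s -> z \in U.
    by move=> zs; rewrite -EU; apply/bigcupP; exists P; rewrite // EP inE.
  have : walk quot [set pi x | x in A :&: U] [set pi x | x in B :&: U] (map pi s).
    case: s ws sU {us EP} => //= x s /and3P[ps xA lB] sU.
    rewrite last_map !imset_f ?inE ?xA ?lB ?sU ?mem_last ?inE ?eqxx // !andbT.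
    elim: s x ps sU {xA lB} => //= y s IH x /andP[exy ps] sU; apply/andP; split.
      apply/exists_inP; exists x; first by rewrite sU ?inE ?eqxx.
      by apply/exists_inP; exists y; rewrite ?sU ?inE ?eqxx ?orbT.
    by apply: IH => // z zs; apply: sU; rewrite inE zs orbT.
  move/sepZ/hasP=> [_ /mapP[x xs ->] /= xZ]; apply/bigcupP; exists (pi x) => //.
  by rewrite inE PPP; apply/exists_inP; exists x; rewrite // EP inE.
have [i | i j z | Q [QI tQ sQ]] := @tight_family_of A B n (fun i => [set z in U | pi z \in w i]).
- have := wP i; case: (w i) => //= a s /and3P[ps /imsetP[x + Ex] /imsetP[y + Ey]].
  rewrite !inE => /andP[xA xU] /andP[yB yU].
  have cxy := lift_path ps xU yU (esym Ex) (esym Ey).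
  have xV : x \in [set z in U | pi z \in a :: s] by rewrite !inE xU -Ex eqxx.
  exact: connect_walk cxy xV xA yB.
- by rewrite !inE => /andP[_ zi] /andP[_ zj]; apply: wD zi zj.
have {}sQ i z : z \in Q i -> z \in U /\ pi z \in w i.
  by move/(subsetP (sQ i)); rewrite inE => /andP.
exists [set Q i | i : 'I_n]; split=> //.
- by rewrite card_imset // card_ord.
- by apply/bigcupsP=> _ /imsetP[i _ ->]; apply/subsetP=> z /sQ[].
move=> _ _ x y /imsetP[i _ ->] /imsetP[j _ ->] /sQ[_ xi] /sQ[_ yj] E.
by congr Q; apply: (wD i j (pi x)); rewrite // E.
Qed.
End Quotient.

(** Each star is contracted to its centre. Afterwards a star with centre [v] on a path meets only
    that path, where tightness bounds the neighbours of [v]. *)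
Lemma star_round A B PP (M : {set T}) (K : T -> {set T}) D n : 0 < D ->
  tight_family A B PP -> M \subset cover PP ->
  (forall v, v \in K v) -> (forall v z, z \in K v -> z != v -> e v z) ->
  {in M &, forall v w, v != w -> [disjoint K v & K w]} ->
  {in M, forall v, #|[set P in PP | [exists x in P, x \in K v]]| <= D} ->
  D * n <= #|PP| ->
  exists QQ, [/\ tight_family A B QQ, #|QQ| = n, cover QQ \subset cover PP &
    {in M, forall v, v \in cover QQ ->
      #|(K v :&: cover QQ) :\ v| + (v \in A) + (v \in B) <= 2}].
Proof.
move=> D0 fPP sM Kv Ke Kd touch leD.
pose pi z := if [pick v in M | z \in K v] is Some v then v else z.
have piK v z : v \in M -> z \in K v -> pi z = v.
  move=> vM zv; rewrite /pi; case: pickP => [w /andP[wM zw] | /(_ v)]; last by rewrite /= vM zv.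
  apply/eqP; apply: contraT => nwv; have := Kd _ _ wM vM nwv.
  by move/pred0P/(_ z); rewrite /= zw zv.
have piP z : (exists2 v, v \in M & z \in K v /\ pi z = v) \/
             (forall v, v \in M -> z \notin K v) /\ pi z = z.
  rewrite /pi; case: pickP => [w /andP[wM zw] | nz]; first by left; exists w.
  by right; split=> // v vM; have := nz v; rewrite /= vM /= => ->.
have [x y xU yU Exy | a | QQ [fQQ cQQ sQQ piQ]] :=
  @quotient_round (cover PP) pi _ A B PP D n D0 fPP (erefl _) _ leD.
- have [[v vM [xv Ex]]|[nx Ex]] := piP x; have [[w wM [yw Ey]]|[ny Ey]] := piP y.
  + have Evw : v = w by rewrite -Ex -Ey.
    have vU := subsetP sM _ vM.
    have cen z : z \in cover PP -> z \in K v ->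
        connect (restr e [set z in cover PP | pi z == pi x]) z v.
      move=> zU zv; have [->|nzv] := eqVneq z v; first exact: connect0.
      apply: connect1; rewrite /restr /= !inE zU vU (piK v z) // (piK v v) // Ex eqxx /=.
      by rewrite se; apply: Ke.
    apply: connect_trans (cen x xU xv) _.
    rewrite sym_connect_sym; last exact: restr_sym.
    by apply: cen; rewrite // Evw.
  + by have := ny v vM; rewrite -Ey -Exy Ex Kv.
  + by have := nx w wM; rewrite -Ex Exy Ey Kv.
  + by rewrite -Ex Exy Ey; apply: connect0.
- have [aM | aM] := boolP (a \in M).
    apply: leq_trans (touch a aM); apply/subset_leq_card/subsetP=> P.
    rewrite !inE => /andP[-> /exists_inP[x xP /eqP Ea]]; apply/exists_inP; exists x => //.
    have [[v vM [xv Ex]]|[nx Ex]] := piP x; first by rewrite -Ea Ex.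
    by rewrite -Ea Ex Kv.
  apply: leq_trans D0; apply: leq_trans (_ : #|[set pblock PP a]| <= _); last by rewrite cards1.
  apply/subset_leq_card/subsetP=> P; rewrite !inE => /andP[PPP /exists_inP[x xP /eqP Ea]].
  have [[v vM [xv Ex]]|[nx Ex]] := piP x; first by rewrite -Ea Ex vM in aM.
  by rewrite -Ea Ex (def_pblock (proj1 fPP) PPP xP).
exists QQ; split=> // v vM vQQ; have [Q QQQ vQ] := bigcupP vQQ.
have [_ /(_ Q QQQ) [_ /(_ v vQ) <-]] := fQQ.
rewrite !leq_add2r; apply/subset_leq_card/subsetP=> z; rewrite !inE.
case/and3P=> nzv zv /bigcupP[Q' QQ' zQ']; rewrite Ke // andbT.
by rewrite (piQ Q Q' v z) // (piK v v) // (piK v z).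
Qed.

(** One [star_round] per colour class. Discarding the paths with a vertex touching many others costs
    a factor 2 and the round a factor [D]; bounds for earlier colours survive because the union only
    shrinks. *)
Lemma star_phase A B U0 (K : T -> {set T}) (col : T -> nat) m D : 0 < D ->
  (forall v, v \in K v) -> (forall v z, z \in K v -> z != v -> e v z) ->
  {in U0, forall v, col v < m} ->
  {in U0 &, forall v w, v != w -> col v = col w -> [disjoint K v & K w]} ->
  (forall PP, tight_family A B PP -> cover PP \subset U0 ->
     2 * #|[set x in cover PP | D <= #|touched e PP x|]| <= #|PP|) ->
  forall n PP, tight_family A B PP -> cover PP \subset U0 -> (2 * D) ^ m * n <= #|PP| ->
  exists QQ, [/\ tight_family A B QQ, n <= #|QQ|, cover QQ \subset cover PP &
    {in cover QQ, forall v, #|(K v :&: cover QQ) :\ v| + (v \in A) + (v \in B) <= 2}].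
Proof.
move=> D0 Kv Ke colm Kd Hred n PP fPP sPP.
suff main j k : (2 * D) ^ j * k <= #|PP| ->
    exists QQ, [/\ tight_family A B QQ, k <= #|QQ|, cover QQ \subset cover PP &
      {in cover QQ, forall v, col v < j ->
         #|(K v :&: cover QQ) :\ v| + (v \in A) + (v \in B) <= 2}].
  move/main=> [QQ [fQQ cQQ sQQ HQQ]]; exists QQ; split=> // v vQ; apply: HQQ => //.
  by apply/colm/(subsetP sPP)/(subsetP sQQ).
elim: j k => [|j IH] k.
  by rewrite mul1n => lek; exists PP; split.
rewrite expnS mulnAC mulnC => /IH[Q1 [fQ1 cQ1 sQ1 HQ1]].
pose X := [set x in cover Q1 | D <= #|touched e Q1 x|].
have sQ1U : cover Q1 \subset U0 by apply: subset_trans sPP.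
have cX : 2 * #|X| <= #|Q1| := Hred _ fQ1 sQ1U.
pose P2 := [set P in Q1 | [disjoint P & X]].
have sP2 : P2 \subset Q1 by apply/subsetP=> P; rewrite inE => /andP[].
have cP2 : D * k <= #|P2|.
  (* Discarded paths contain different vertices of [X], so at most half of the paths are lost. *)
  have : #|Q1 :\: P2| <= #|X|.
    apply: leq_trans (leq_imset_card (pblock Q1) X); apply/subset_leq_card/subsetP=> P.
    rewrite !inE => /andP[+ PQ1]; rewrite PQ1 /= => /pred0Pn[x /andP[/= xP xX]].
    by apply/imsetP; exists x => //; rewrite (def_pblock (proj1 fQ1) PQ1 xP).
  have := cardsID P2 Q1; rewrite (setIidPr sP2); move: cQ1 cX; clear.
  move: #|Q1 :\: P2| #|P2| #|Q1| #|X| => a b c d; nia.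
have fP2 : tight_family A B P2.
  split; last by move=> P /(subsetP sP2); apply: (proj2 fQ1).
  exact: trivIsetS sP2 (proj1 fQ1).
have cvP2 : cover P2 \subset cover Q1.
  by apply/bigcupsP=> P /(subsetP sP2) PQ1; apply: member_sub.
pose M := [set v in cover P2 | col v == j].
have MU v : v \in M -> v \in U0.
  by rewrite inE => /andP[/(subsetP cvP2)/(subsetP sQ1U)].
have [|v w vM wM nvw|v vM|QQ [fQQ cQQ sQQ HQQ]] :=
  @star_round A B P2 M K D k D0 fP2 _ Kv Ke _ _ cP2.
- by apply/subsetP=> v; rewrite inE => /andP[].
- apply: Kd => //; [exact: MU|exact: MU|].
  by move: vM wM; rewrite !inE => /andP[_ /eqP->] /andP[_ /eqP->].
- have vP2 : v \in cover P2 by move: vM; rewrite inE => /andP[].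
  have vX : v \notin X.
    have [P] := bigcupP vP2; rewrite inE => /andP[_ dPX] vP.
    by rewrite (disjointFr dPX vP).
  apply: leq_trans (_ : #|touched e Q1 v| <= _); last first.
    rewrite leqNgt; apply: contra vX => /ltnW le; rewrite inE le andbT.
    exact: (subsetP cvP2).
  apply/subset_leq_card/subsetP=> P; rewrite !inE => /andP[/andP[-> _] /exists_inP[x xP xK]].
  apply/exists_inP; exists x => //; have [//|nxv] := eqVneq x v.
  exact: Ke.
exists QQ; split=> //; first by rewrite cQQ.
  by apply: subset_trans sQQ (subset_trans cvP2 sQ1).
move=> v vQ; rewrite ltnS leq_eqVlt => /orP[cj | ltj].
  by apply: HQQ => //; rewrite inE cj (subsetP sQQ).
have vQ1 : v \in cover Q1 by apply/(subsetP cvP2)/(subsetP sQQ).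
apply: leq_trans (HQ1 v vQ1 ltj); rewrite !leq_add2r; apply: subset_leq_card.
by apply: setSD; apply: setIS; apply: subset_trans sQQ cvP2.
Qed.
End Rounds.

(** * The induced Menger theorem *)

Lemma greedy_coloring (T : finType) (R : rel T) d : symmetric R ->
  (forall v, #|[set w | R v w]| <= d) ->
  exists col : T -> nat, (forall v, col v < d.+1) /\
    forall v w, v != w -> R v w -> col v != col w.
Proof.
move=> sR dR.
suff main (S : {set T}) : exists col : T -> nat, (forall v, col v < d.+1) /\
    {in S &, forall v w, v != w -> R v w -> col v != col w}.
  have [col [cm cP]] := main setT; exists col; split=> // v w.
  by apply: cP; rewrite inE.
have [n] := ubnP #|S|; elim: n S => // n IH S ltS.
have [-> | [v vS]] := set_0Vmem S.
  by exists (fun=> 0); split=> // v w; rewrite inE.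
have [|col [cm cP]] := IH (S :\ v).
  by move: ltS; rewrite (cardsD1 v) vS.
have [|c cd cN] := @fresh_color T [set w | R v w] col d.+1; first by rewrite ltnS.
exists (fun x => if x == v then c else col x); split=> [x|x y xS yS nxy Rxy].
  by case: ifP.
have [Ex|nx] := eqVneq x v; have [Ey|ny] := eqVneq y v.
- by rewrite Ex Ey eqxx in nxy.
- by rewrite eq_sym; apply: cN; rewrite inE -Ex.
- by apply: cN; rewrite inE -Ey sR.
- by apply: cP; rewrite // !inE ?nx ?ny.
Qed.

Section Phases.
Variables (T : finType) (C : {set T} -> rel T -> Prop) (r : nat) (e : rel T).
Hypotheses (cC : closed_class C) (r0 : 0 < r) (fC : clique_free r C).
Hypothesis CT : C setT e.
Variables A B : {set T}.
Let se := class_sym cC CT.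
Let ie := class_irr cC CT.

Lemma touch_bound_gt0 : 0 < touch_bound r. Proof. by rewrite /touch_bound; lia. Qed.

Lemma tight_few_touching PP : tight_family e A B PP ->
  2 * #|[set x in cover PP | touch_bound r <= #|touched e PP x|]| <= #|PP|.
Proof.
move=> [tPP tight_PP]; apply: (few_touching_many cC r0 fC CT tPP); first exact: subsetT.
move=> P /tight_PP[[s [us ws ->]] _]; exists s; split=> //.
by case: s ws {us} => //= x s /and3P[].
Qed.

(** Earlier neighbours, plus the at most two later ones that [star_phase] leaves. *)
Definition maxdeg := back_degree r + 2.

Lemma bounded_degree_phase PP n : tight_family e A B PP ->
  (2 * touch_bound r) ^ ncolors r * n <= #|PP| ->
  exists QQ, [/\ tight_family e A B QQ, n <= #|QQ| &
    {in cover QQ, forall v, #|nbh e (cover QQ) v| <= maxdeg}].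
Proof.
move=> fPP leP.
have [rk [col [colm rkB rkI Kd]]] := rank_coloring cC r0 fC CT.
have [v|v z|v _|v w _ _ nvw Ec|PP' fPP' _|QQ [fQQ cQQ _ HQQ]] :=
  @star_phase _ e se ie A B setT (star setT e rk) col (ncolors r) (touch_bound r) touch_bound_gt0
    _ _ _ _ _ n PP fPP (subsetT _) leP.
- by rewrite setU11.
- by rewrite !inE => /orP[->//|/and3P[]].
- exact: colm.
- by apply: Kd; rewrite ?inE.
- exact: tight_few_touching.
exists QQ; split=> // v vQ; set U := cover QQ.
apply: leq_trans (_ : #|[set w in setT | (rk w < rk v) && e v w] :|:
  (star setT e rk v :&: U) :\ v| <= _).
  apply/subset_leq_card/subsetP=> w; rewrite !inE => /andP[wU evw].
  have nwv : w != v by apply: contraTneq evw => ->; rewrite ie.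
  rewrite nwv evw wU (negPf nwv) /= !andbT; case: ltngtP => // E.
  by case/eqP: nwv; apply: rkI; rewrite ?inE.
apply: leq_trans (leq_card_setU _ _) _; apply: leq_add; first exact: rkB (in_setT v).
by have := HQQ v vQ; rewrite -addnA; apply: leq_trans; apply: leq_addr.
Qed.

(** Two closed neighbourhoods meet only for vertices at distance at most 2, which bounds the
    conflicts of a greedy colouring. *)
Definition square_ncolors := (maxdeg.+1 * maxdeg.+1).+1.

Lemma induced_phase PP n : tight_family e A B PP ->
  {in cover PP, forall v, #|nbh e (cover PP) v| <= maxdeg} ->
  (2 * touch_bound r) ^ square_ncolors * n <= #|PP| ->
  exists QQ, [/\ tight_family e A B QQ, n <= #|QQ| &
    {in cover QQ, forall v, #|nbh e (cover QQ) v| + (v \in A) + (v \in B) <= 2}].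
Proof.
move=> fPP degU leP; set U := cover PP in degU.
pose K v := v |: nbh e U v.
pose R := [rel v w | [&& v \in U, w \in U & ~~ [disjoint K v & K w]]].
have KU v z : v \in U -> z \in K v -> z \in U.
  by move=> vU; rewrite !inE => /orP[/eqP->|/andP[]].
have cK v : v \in U -> #|K v| <= maxdeg.+1.
  by move=> vU; rewrite cardsU1; have := degU v vU; case: (v \notin _) => /=; lia.
have [|v|col [colm colR]] := @greedy_coloring T R (maxdeg.+1 * maxdeg.+1).
- by move=> v w; rewrite /R /= disjoint_sym andbCA.
- have [vU | vU] := boolP (v \in U); last first.
    by rewrite (_ : [set w | R v w] = set0) ?cards0 //; apply/setP=> w;
       rewrite !inE /= (negPf vU).
  apply: leq_trans (_ : #|\bigcup_(z in K v) K z| <= _).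
    apply/subset_leq_card/subsetP=> w; rewrite inE /= => /and3P[_ wU /pred0Pn[z /andP[/= zv zw]]].
    apply/bigcupP; exists z => //; move: zw; rewrite !inE => /orP[/eqP->|/andP[_ ewz]].
      by rewrite eqxx.
    by rewrite wU se ewz orbT.
  apply: leq_trans (card_bigcup_le _ _) _.
  apply: leq_trans (_ : #|K v| * maxdeg.+1 <= _); last by rewrite leq_mul2r cK ?orbT.
  rewrite -sum_nat_const; apply: leq_sum => z zv; apply: cK; exact: KU zv.
have [v|v z|v _|v w vU wU nvw Ec|PP' fPP' _|QQ [fQQ cQQ sQQ HQQ]] :=
  @star_phase _ e se ie A B U K col square_ncolors (touch_bound r) touch_bound_gt0
    _ _ _ _ _ n PP fPP (subxx _) leP.
- by rewrite setU11.
- by rewrite !inE => /orP[->//|/andP[]].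
- exact: colm.
- by apply: contraT => nd; have := colR v w nvw; rewrite /= vU wU nd Ec eqxx => /(_ isT).
- exact: tight_few_touching.
exists QQ; split=> // v vQ; apply: leq_trans (HQQ v vQ); rewrite !leq_add2r.
apply/subset_leq_card/subsetP=> z; rewrite !inE => /andP[zQ evz].
have nzv : z != v by apply: contraTneq evz => ->; rewrite ie.
by rewrite nzv zQ evz (subsetP sQQ) ?orbT.
Qed.

Definition menger_factor := (2 * touch_bound r) ^ ncolors r * (2 * touch_bound r) ^ square_ncolors.

Lemma induced_menger k :
  (exists P : 'I_k -> seq T, [/\ forall i, walk e A B (P i) /\ uniq (P i) &
     forall i j u v, i != j -> u \in P i -> v \in P j -> (u != v) && ~~ e u v]) \/
  (exists2 Z, separates e A B Z & #|Z| < k * menger_factor).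
Proof.
have [[w [wP wD]] | ] := menger e A B (k * menger_factor); last by right.
have [i|i j z|Q0 [Q0I fQ0 _]] :=
  @tight_family_of _ e se ie A B _ (fun i => [set z in w i]).
- by exists (w i) => // z; rewrite inE.
- by rewrite !inE; apply: wD.
left.
have [|Q1 [fQ1 cQ1 dQ1]] :=
  @bounded_degree_phase _ ((2 * touch_bound r) ^ square_ncolors * k) fQ0.
  by rewrite mulnA card_imset // card_ord mulnC.
have [Q2 [fQ2 cQ2 lQ2]] := induced_phase fQ1 dQ1 cQ1.
have [QQ sQQ cQQ] := subset_of_size cQ2.
have [tQ2 tight_Q2] := fQ2.
pose Q (i : 'I_k) := enum_val (cast_ord (esym cQQ) i).
have QQ2 i : Q i \in Q2 by apply/(subsetP sQQ)/enum_valP.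
have QI : injective Q by move=> i j /enum_val_inj /cast_ord_inj.
have /fin_all_exists[P PP] i : exists s, [/\ uniq s, walk e A B s & Q i = [set z in s]].
  by have [] := tight_Q2 _ (QQ2 i).
exists P; split=> [i|i j u v nij]; first by case: (PP i).
have [_ _ Ei] := PP i; have [_ _ Ej] := PP j.
have -> : (u \in P i) = (u \in Q i) by rewrite Ei inE.
have -> : (v \in P j) = (v \in Q j) by rewrite Ej inE.
move=> uQ vQ; have dQ : [disjoint Q i & Q j].
  by apply: (trivIsetP tQ2); rewrite ?(inj_eq QI).
have vQi : v \notin Q i by rewrite (disjointFl dQ vQ).
apply/andP; split; first by apply: contraNneq vQi => <-.
apply/negP=> euv.
have uU : u \in cover Q2 by apply: (subsetP (member_sub (QQ2 i))).
have vU : v \in cover Q2 by apply: (subsetP (member_sub (QQ2 j))).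
have [_ /(_ u uQ) load] := tight_Q2 _ (QQ2 i).
(* Within its own path [u] already has load exactly 2; the neighbour [v] on another path would raise
   it to 3. *)
have := lQ2 u uU; rewrite leqNgt -{}load -!addnA ltn_add2r => /negP[].
apply: leq_trans (_ : #|v |: nbh e (Q i) u| <= _).
  by rewrite cardsU1 inE (negPf vQi).
apply/subset_leq_card/subsetP=> z; rewrite !inE => /orP[/eqP->|/andP[zQ ->]].
  by rewrite vU euv.
by rewrite andbT; apply: (subsetP (member_sub (QQ2 i))).
Qed.
End Phases.

Theorem theorem1p3 :
  exists h : sgraph -> nat,
    (forall H : sgraph, 0 < h H) /\
    forall (H G : sgraph) (A B : {set G}),
      ~ topological_minor H G ->
      forall k : nat, 0 < k ->
        (exists P : 'I_k -> seq G,
           (forall i : 'I_k, AB_path A B (P i)) /\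
           (forall i j : 'I_k, i != j ->
              vertex_disjoint (P i) (P j) /\ anticomplete (P i) (P j)))
        \/
        (exists S : {set G}, AB_separator A B S /\ #|S| <= k * h H).
Proof.
exists (fun H : sgraph => menger_factor #|H|.+1); split=> [H | H G A B nHG k _].
  by rewrite /menger_factor muln_gt0 !expn_gt0 !muln_gt0 !touch_bound_gt0.
(* The graph [ind] on all vertices is a copy of [G]. *)
have CT : tm_free H setT (@edge G).
  split; [exact: edge_sym|exact: edge_irrefl|move=> tm; apply: nHG].
  apply: topological_minor_subgraph tm; exists val; first exact: val_inj.
  by move=> x y; rewrite /= /ind_edge (edge_sym (val y)) orbb => /andP[].
have [[P [wP dP]] | [Z sepZ ltZ]] :=
  induced_menger (@tm_free_closed G H) (ltn0Sn #|H|) (@tm_free_clique_free G H) CT A B k.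
- left; exists P; split=> [i | i j nij].
    by have [] := wP i; case: (P i) => //= x s /and3P[-> -> ->] ->.
  split=> [v vi | u v ui vj]; last by have /andP[] := dP i j u v nij ui vj.
  by apply/negP=> vj; have := dP i j v v nij vi vj; rewrite eqxx.
right; exists Z; split; last exact: ltnW.
move=> p pP; have /hasP[v vp vZ] : has (mem Z) p; last by exists v.
by apply: sepZ; case: p pP => //= x s /and4P[_ -> -> ->].
Qed.
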